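(* Let $m\in\mathbb N\setminus\{0\}$ and $p\in\mathbb N$. Assume that: (1) $f$ is bounded on $I$; (2) for every $j\in\{1,\dots,m\}$, $\varphi_j'\in\mathcal S_{j+p}$; (3) for every $j\in\{1,\dots,m\}$, $b(\underline{a})\varphi_j(\underline{a})=b(\overline{a})\varphi_j(\overline{a})$, where $\underline a=\inf(I)$ and $\overline a=\sup(I)$. Then $$\begin{aligned}\mathbb E\left[\|\widehat b_m^{\prime,2}-b'\|_n^2\right]\leqslant{}&2\|f\|_\infty\inf_{t\in\mathcal S_m}\|t-b'\|^2+2\,\mathbb E\left[\|\widehat\Phi_m\Delta_{m,m+p}(\widehat\Phi_{m+p}^*\widehat\Phi_{m+p})^{-1}\widehat\Phi_{m+p}^*\|_{\rm op}^2\,\|b-b_{m+p}\|_n^2\right]\\&+\frac{\sigma^2}{n}\mathbb E\left[{\rm Tr}\left((\widehat\Phi_{m+p}^*\widehat\Phi_{m+p})^{-1}\Delta_{m,m+p}^*\widehat\Phi_m^*\widehat\Phi_m\Delta_{m,m+p}\right)\right].\end{aligned}$$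
   Context: Model: $Y_i=b(X_i)+\varepsilon_i$, $i=1,\dots,n$, where $b$ is an unknown continuously differentiable function, $X_1,\dots,X_n$ are i.i.d. real random variables with density $f$ with respect to Lebesgue measure, and $\varepsilon_1,\dots,\varepsilon_n$ are i.i.d., centered, with variance $\sigma^2$, and independent of $X_1,\dots,X_n$. $I\subseteq\mathbb R$ is an interval and $(\varphi_j)_{j\geqslant 1}$ is a Hilbert (orthonormal) basis of $\mathbb L^2(I,dx)$ made of differentiable functions, extended by $0$ outside $I$. $\mathcal S_m={\rm span}\{\varphi_1,\dots,\varphi_m\}$. Estimation takes place on $I$: $b$ and $b'$ stand for $b\mathbf 1_I$ and $b'\mathbf 1_I$, and $b,b'$ are square integrable on $I$. $b_{m+p}$ is the $\mathbb L^2(I,dx)$-orthogonal projection of $b$ on $\mathcal S_{m+p}$. Boundary values at an infinite endpoint of $I$ are understood as limits. Norms: $\|\cdot\|$ is the norm of $\mathbb L^2(I,dx)$; $\|\psi\|_n^2=\frac1n\sum_{i=1}^n\psi(X_i)^2$; $\|f\|_\infty=\sup_I f$; $\|M\|_{\rm op}^2=\lambda_{\max}(MM^* )$, with $M^*$ the transpose of $M$. Matrices: $\widehat\Phi_m=(\varphi_j(X_i))_{1\leqslant i\leqslant n,1\leqslant j\leqslant m}$, $\widehat\Psi_m=\frac1n\widehat\Phi_m^*\widehat\Phi_m$, with $\widehat\Psi_{m+p}$ assumed almost surely invertible, $\mathbf Y=(Y_1,\dots,Y_n)^*$. Under (2), $\Delta_{m,m+p}$ is the $m\times(m+p)$ matrix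 with $\varphi_j'=\sum_{k=1}^{m+p}[\Delta_{m,m+p}]_{j,k}\varphi_k$ for $j=1,\dots,m$; equivalently $\widehat\Phi_m'=\widehat\Phi_{m+p}\Delta_{m,m+p}^*$ with $\widehat\Phi_m'=(\varphi_j'(X_i))_{i,j}$. Estimator: $\widehat b_m^{\prime,2}(x)=\sum_{j=1}^m[\widehat\theta_m^2]_j\varphi_j(x)$ with $\widehat\theta_m^2=-\frac1n\Delta_{m,m+p}\widehat\Psi_{m+p}^{-1}\widehat\Phi_{m+p}^*\mathbf Y$. *)

(* Defs.v *)
From HB Require Import structures.
From mathcomp Require Import all_boot all_order all_algebra.
From mathcomp Require Import all_classical all_reals all_analysis.

Set Implicit Arguments.
Unset Strict Implicit.
Unset Printing Implicit Defensive.

Import Order.TTheory GRing.Theory Num.Theory.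
Import numFieldNormedType.Exports.

Local Open Scope classical_set_scope.
Local Open Scope ring_scope.

Section Functions.
Context {R : realType}.
Implicit Types (I : set R) (f g h b : R -> R) (phi : nat -> R -> R).

(* Derivative relative to I: one-sided at an endpoint that belongs to I, the
   usual derivative at interior points. It is needed because a function
   extended by 0 outside I need not be differentiable, as a function on the
   whole line, at the endpoints of I. [f \_ I] is f on I and 0 elsewhere. *)
Definition derivable_on I f : Prop :=
  forall x, I x -> cvg ((fun y => (f y - f x) / (y - x)) @ within I x^').

Definition derive_on I f : R -> R :=
  (fun x => lim ((fun y => (f y - f x) / (y - x)) @ within I x^')) \_ I.

(* Filters of the points of I approaching inf I and sup I. For nonempty I,
   inf I = +oo and sup I = -oo cannot occur. *)
Definition near_inf I : set_system R :=
  match ereal_inf [set x%:E | x in I] with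
  | a%:E => a^'+
  | -oo%E => ninfty_nbhs R
  | +oo%E => pinfty_nbhs R
  end.

Definition near_sup I : set_system R :=
  match ereal_sup [set x%:E | x in I] with
  | a%:E => a^'-
  | +oo%E => pinfty_nbhs R
  | -oo%E => ninfty_nbhs R
  end.

(* g(inf I) = g(sup I), boundary values being limits from inside I. At an
   endpoint which belongs to I this is the value of g there as soon as g is
   continuous on I; at a finite endpoint outside I, the limit is the only
   meaningful value for functions that are extended by 0 outside I. *)
Definition equal_boundary_values I g : Prop :=
  exists l : R, g @ near_inf I --> l /\ g @ near_sup I --> l.

Definition L2 I f : Prop := f \_ I \in Lfun (@lebesgue_measure R) 2%:E.

Definition L2norm I f : \bar R :=
  'N[@lebesgue_measure R]_2%:E [EFin \o (f \_ I)].

Definition L2inner I f g : R :=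
  \int[@lebesgue_measure R]_(x in I) (f x * g x).

(* phi 0, phi 1, ... stand for phi_1, phi_2, ... : [Sspan phi k] is the span
   of the first k functions. *)
Definition Sspan phi (k : nat) : set (R -> R) :=
  [set (fun x => \sum_(j < k) c j * phi j x) | c in [set: 'I_k -> R]].

Definition hilbert_basis I phi : Prop :=
  [/\ forall j, L2 I (phi j),
      forall j k, L2inner I (phi j) (phi k) = (j == k)%:R
    & forall g, L2 I g -> forall e : R, 0 < e ->
        exists k, exists2 t, Sspan phi k t & (L2norm I (g \- t)%R < e%:E)%E].

Definition is_orth_proj I (S : set (R -> R)) g t : Prop :=
  S t /\ forall s, S s -> L2inner I (g \- t) s = 0.

(* Largest eigenvalue (used for symmetric matrices, whose eigenvalues are all
   real) and operator norm, ||M||_op^2 = lambda_max (M M^T). *)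
Definition lambda_max n (A : 'M[R]_n) : R := sup [set a | eigenvalue A a].

Definition op_norm n k (M : 'M[R]_(n, k)) : R := Num.sqrt (lambda_max (M *m M^T)).

End Functions.

Section Probability.
Context d (Omega : measurableType d) (R : realType) (P : probability Omega R).
Context (n : nat).
Implicit Types X Y : 'I_n -> {RV P >-> R}.

Definition mutually_independent X : Prop :=
  forall (J : {set 'I_n}) (A : 'I_n -> set R), (forall i, measurable (A i)) ->
    P (\bigcap_(i in [set` J]) (X i @^-1` A i)) =
    (\prod_(i in J) P (X i @^-1` A i))%E.

Definition identically_distributed X : Prop :=
  forall i j (A : set R), measurable A ->
    distribution P (X i) A = distribution P (X j) A.

Definition iid X : Prop := mutually_independent X /\ identically_distributed X.

(* Independence of the random vectors X and Y, i.e. of the sigma-algebras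
   that they generate. *)
Definition independent_vectors X Y : Prop :=
  forall A B : set Omega,
    g_sigma_preimage (fun i => X i : Omega -> measurableTypeR R) A ->
    g_sigma_preimage (fun i => Y i : Omega -> measurableTypeR R) B ->
    P (A `&` B) = (P A * P B)%E.

Definition has_density (Z : {RV P >-> R}) (f : R -> R) : Prop :=
  [/\ measurable_fun setT f, forall x, 0 <= f x
    & forall A : set R, measurable A ->
        distribution P Z A = (\int[@lebesgue_measure R]_(x in A) (f x)%:E)%E].

End Probability.

(* The sample is given by its values x = (X_1, ..., X_n) and y = (Y_1, ..., Y_n)
   at one outcome. *)
Section Estimation.
Context {R : realType} (phi : nat -> R -> R) (n : nat).
Implicit Types (x : 'I_n -> R) (y : 'cV[R]_n).

Definition emp_norm2 x (psi : R -> R) : R :=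
  n%:R^-1 * \sum_(i < n) psi (x i) ^+ 2.

Definition Phi_hat (k : nat) x : 'M[R]_(n, k) := \matrix_(i, j) phi j (x i).

Definition Psi_hat (k : nat) x : 'M[R]_k :=
  n%:R^-1 *: ((Phi_hat k x)^T *m Phi_hat k x).

Definition theta_hat (m p : nat) (Delta : 'M[R]_(m, m + p)) x y : 'cV[R]_m :=
  - (n%:R^-1 *:
     (Delta *m invmx (Psi_hat (m + p) x) *m (Phi_hat (m + p) x)^T *m y)).

Definition b_hat' (m p : nat) (Delta : 'M[R]_(m, m + p)) x y : R -> R :=
  fun u => \sum_(j < m) theta_hat Delta x y j 0 * phi j u.

End Estimation.

(* Main.v *)
Require Import Defs.
From HB Require Import structures.
From mathcomp Require Import all_boot all_order all_algebra.
From mathcomp Require Import all_classical all_reals all_analysis.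
From mathcomp Require Import measurable_realfun ring lra.

Set Implicit Arguments.
Unset Strict Implicit.
Unset Printing Implicit Defensive.

Import Order.TTheory GRing.Theory Num.Theory.
Import numFieldNormedType.Exports.

Local Open Scope classical_set_scope.
Local Open Scope ring_scope.

(** Let [H] be the matrix inside the operator norm of the theorem, [bI] and [b'I]
    the restrictions of [b] and [b'] to [I], and [b'_m] the projection of [b'] on
    [S_m]. Integrating by parts, which is where the boundary condition enters,
    the coefficients of [b'_m] are minus [Delta] applied to those of [b_(m+p)];
    hence [H] maps the values of [b_(m+p)] at the sample to minus those of [b'_m],
    and at the sample points
      [b_hat' - b'I = - ((b'I - b'_m) + H (bI - b_(m+p)) + H eps)].
    The first two terms depend on [X] only, and [eps] is centered and independent
    of [X], so the expected squared norm splits without cross term into the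
    contribution of these two terms (this is why only they get the factor 2 of
    [(s + t)^2 <= 2 s^2 + 2 t^2]) and the one of [H eps], which is [sigma^2] times
    the expected squared Frobenius norm of [H], that is the trace. No moment of
    [H] is assumed finite: the splitting is proved on the events where [H] and
    [(b'I - b'_m) + H (bI - b_(m+p))] are bounded by [k], and [k] tends to infinity. *)

(** * Operator norm *)

Section RealSymmetric.
Context {R : realType}.

Lemma mulmx_trmx11 n (u v : 'rV[R]_n) :
  (u *m v^T) 0 0 = \sum_i u 0 i * v 0 i.
Proof. by rewrite mxE; apply: eq_bigr => i _; rewrite mxE. Qed.

Let subE11 (A B : 'M[R]_1) : (A - B) 0 0 = A 0 0 - B 0 0.
Proof. by rewrite !mxE. Qed.

Let addE11 (A B : 'M[R]_1) : (A + B) 0 0 = A 0 0 + B 0 0.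
Proof. by rewrite mxE. Qed.

Let scaleE11 (c : R) (A : 'M[R]_1) : (c *: A) 0 0 = c * A 0 0.
Proof. by rewrite mxE. Qed.

Lemma row_sqr_ge0 n (u : 'rV[R]_n) : 0 <= (u *m u^T) 0 0.
Proof. by rewrite mulmx_trmx11 sumr_ge0// => i _; rewrite -expr2 sqr_ge0. Qed.

Lemma row_sqr_eq0 n (u : 'rV[R]_n) : (u *m u^T) 0 0 = 0 -> u = 0.
Proof.
rewrite mulmx_trmx11 => /psumr_eq0P u0; apply/rowP => i; rewrite mxE.
by apply/eqP; rewrite -sqrf_eq0 expr2 u0// => j _; rewrite -expr2 sqr_ge0.
Qed.

Lemma quadratic_form_continuous n (S : 'M[R]_n) :
  continuous (fun u : 'rV[R]_n => (u *m S *m u^T) 0 0).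
Proof.
move=> u.
rewrite (_ : (fun _ => _) =
    (fun u : 'rV[R]_n => \sum_i (\sum_j u 0 j * S j i) * u 0 i)); last first.
  apply/funext => v; rewrite mulmx_trmx11.
  by apply: eq_bigr => i _; rewrite mxE.
apply: (@cvg_big _ _ _ _ _ _ _ (nbhs u)) => [|i _]; first exact: add_continuous.
apply: cvgM; last exact: coord_continuous.
apply: (@cvg_big _ _ _ _ _ _ _ (nbhs u)) => [|j _]; first exact: add_continuous.
by apply: cvgM; [exact: coord_continuous|exact: cvg_cst].
Qed.

(** The norm on row vectors is the largest absolute value of an entry, and every entry is at most 1
    in absolute value on the Euclidean sphere. *)
Lemma unit_sphere_compact n :
  compact [set u : 'rV[R]_n | (u *m u^T) 0 0 = 1].
Proof.
apply: bounded_closed_compact.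
  exists 1; split; first exact: num_real.
  move=> M M1 u /= u1; apply: le_trans (ltW M1).
  rewrite [leLHS]/Num.norm /= mx_normrE; apply/bigmax_leP; split => // -[i j] _ /=.
  rewrite (ord1 i) -(@ler_pXn2r _ 2)// ?nnegrE// expr1n real_normK ?num_real//.
  rewrite -u1 mulmx_trmx11 (bigD1 j)//= expr2 lerDl sumr_ge0// => k _.
  by rewrite -expr2 sqr_ge0.
rewrite (_ : [set _ | _] =
    (fun u : 'rV[R]_n => (u *m 1%:M *m u^T) 0 0) @^-1` [set 1]); last first.
  by apply/seteqP; split=> u /=; rewrite mulmx1.
apply: preimage_closed; last exact: closed_eq.
by move=> u _; exact: quadratic_form_continuous.
Qed.

(** Rayleigh's argument: the form of [S] has a maximum [a] on the compact unit sphere, and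
    homogeneity gives the bound for every [u]. A maximizer [v] is an eigenvector because [a%:M - S]
    is positive semidefinite and its form vanishes at [v]. *)
Lemma max_eigenvalue n (S : 'M[R]_n.+1) : S^T = S ->
  exists2 a, eigenvalue S a &
    forall u : 'rV_n.+1, (u *m S *m u^T) 0 0 <= a * (u *m u^T) 0 0.
Proof.
move=> Ssym.
have [||v] := @compact_EVT_max _ _ (fun u : 'rV[R]_n.+1 => (u *m S *m u^T) 0 0)
    _ _ (@unit_sphere_compact n.+1).
- exists (delta_mx 0 0); rewrite /= mulmx_trmx11 (bigD1 ord0)//= !mxE/= mulr1.
  by rewrite big1 ?addr0// => i /negbTE i0; rewrite !mxE /= i0 mulr0.
- exact/continuous_subspaceT/quadratic_form_continuous.
rewrite inE /= => v1; set a := (v *m S *m v^T) 0 0 => vmax.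
have Sa (u : 'rV[R]_n.+1) : (u *m S *m u^T) 0 0 <= a * (u *m u^T) 0 0.
  have [->|u0] := eqVneq u 0; first by rewrite !mul0mx mxE mulr0.
  have uu : 0 < (u *m u^T) 0 0.
    by rewrite lt_def row_sqr_ge0 andbT; apply: contra_neq u0 => /row_sqr_eq0.
  pose c := Num.sqrt ((u *m u^T) 0 0).
  have cc : c ^+ 2 = (u *m u^T) 0 0 by rewrite sqr_sqrtr// ltW.
  have c0 : 0 < c by rewrite sqrtr_gt0.
  have := vmax (c^-1 *: u); rewrite inE /= linearZ/= -!scalemxAl -!scalemxAr.
  rewrite !scaleE11 -cc mulrA -expr2 exprVn mulVf ?sqrf_eq0 ?gt_eqF//.
  by move=> /(_ erefl); rewrite mulrA -expr2 exprVn mulrC ler_pdivrMr ?exprn_gt0.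
exists a => //; apply/eigenvalueP; exists v; last first.
  by apply: contra_eq_neq v1 => ->; rewrite mul0mx mxE eq_sym oner_eq0.
have [T Tdef] : {T | T = a%:M - S} by exists (a%:M - S).
have TE (u : 'rV[R]_n.+1) :
    (u *m T *m u^T) 0 0 = a * (u *m u^T) 0 0 - (u *m S *m u^T) 0 0.
  by rewrite Tdef mulmxBr mulmxBl mul_mx_scalar -scalemxAl subE11 scaleE11.
have T0 (u : 'rV[R]_n.+1) : 0 <= (u *m T *m u^T) 0 0 by rewrite TE subr_ge0.
pose z := v *m T.
suff z0 : z = 0.
  apply/eqP; rewrite eq_sym -subr_eq0; apply/eqP.
  by rewrite -mul_mx_scalar -mulmxBr -Tdef.
apply: row_sqr_eq0; set q := (z *m z^T) 0 0.
pose c := (z *m T *m z^T) 0 0.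
(* [v] minimizes the form of [T] with value 0, so the first-order term
   [q] of its expansion at [v] in the direction [z = v T] vanishes. *)
have expand t : 0 <= 2 * t * q + t ^+ 2 * c.
  rewrite (le_trans (T0 (v + t *: z)))// le_eqVlt; apply/orP; left; apply/eqP.
  rewrite [(_ + _)^T]linearD /= [(_ *: _)^T]linearZ/= mulmxDl !mulmxDr !mulmxDl.
  rewrite -!scalemxAl -!scalemxAr -/z.
  have -> : z *m T *m v^T = z *m z^T.
    rewrite -mulmxA; congr (_ *m _); rewrite /z trmx_mul; congr (_ *m _).
    by rewrite Tdef linearB /= tr_scalar_mx Ssym.
  rewrite -/z !(addE11, scaleE11) -/q -/c TE v1 mulr1 subrr.
  ring.
have q0 : 0 <= q by exact: row_sqr_ge0.
have c0 : 0 <= c by exact: T0.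
(* This value of [t] turns the expansion into [- q ^+ 2] times a positive factor; the [+ 1] keeps
   the denominator positive when [c = 0]. *)
have := expand (- q / (c + 1)).
have -> : 2 * (- q / (c + 1)) * q + (- q / (c + 1)) ^+ 2 * c =
    - (q ^+ 2 * ((c + 2) / (c + 1) ^+ 2)).
  by field; rewrite gt_eqF// ltr_wpDl.
rewrite oppr_ge0 pmulr_lle0 ?divr_gt0 ?exprn_gt0 ?ltr_wpDl//.
by move=> q20; apply/eqP; rewrite -sqrf_eq0 eq_le q20 sqr_ge0.
Qed.

(** The norm is defined by the eigenvalues of [M M^T], the largest of which is the [a] of
    [max_eigenvalue]. With [z = (M v)^T M], the bound [|z|^2 <= a |M v|^2] and the expansion of
    [|z - a v^T|^2 >= 0] give [a |M v|^2 <= a^2 |v|^2]. *)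
Lemma op_norm_mulmx n k (M : 'M[R]_(n, k)) (v : 'cV[R]_k) : (0 < n)%N ->
  \sum_i (M *m v) i 0 ^+ 2 <= op_norm M ^+ 2 * \sum_i v i 0 ^+ 2.
Proof.
case: n M => // n M _.
have sqE j (w : 'cV[R]_j) : \sum_i w i 0 ^+ 2 = (w^T *m w^T^T) 0 0.
  by rewrite mulmx_trmx11; apply: eq_bigr => i _; rewrite mxE expr2.
rewrite !sqE; set w := (M *m v)^T.
have [|a Sa maxa] := @max_eigenvalue _ (M *m M^T).
  by rewrite trmx_mul trmxK.
have formE (u : 'rV_n.+1) : u *m (M *m M^T) *m u^T = u *m M *m (u *m M)^T.
  by rewrite trmx_mul !mulmxA.
have a0 : 0 <= a.
  move/eigenvalueP : Sa => [u uS u0].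
  have := row_sqr_ge0 (u *m M); rewrite -formE uS -scalemxAl mxE.
  rewrite pmulr_lge0// lt_def row_sqr_ge0 andbT.
  by apply: contra_neq u0 => /row_sqr_eq0.
have le_a e : eigenvalue (M *m M^T) e -> e <= a.
  move=> /eigenvalueP [u uS u0].
  have := maxa u; rewrite uS -scalemxAl mxE ler_pM2r// lt_def row_sqr_ge0 andbT.
  by apply: contra_neq u0 => /row_sqr_eq0.
have -> : op_norm M ^+ 2 = a.
  rewrite /op_norm (_ : lambda_max _ = a) ?sqr_sqrtr//.
  apply/eqP; rewrite eq_le; apply/andP; split.
    by apply: ge_sup; first by exists a.
  by apply: ub_le_sup => //; exists a.
set z := w *m M; set t := (w *m w^T) 0 0.
have zt : (z *m v) 0 0 = t by rewrite /z -mulmxA -[M *m v]trmxK.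
have zz : (z *m z^T) 0 0 <= a * t by rewrite -formE maxa.
(* The final division by [a] needs [a > 0]; for [a = 0], [z] vanishes and so does
   [|M v|^2 = z v]. *)
have [a_eq0|a_neq0] := eqVneq a 0.
  have /row_sqr_eq0 z0 : (z *m z^T) 0 0 = 0.
      by apply/eqP; rewrite eq_le row_sqr_ge0 -(mul0r t) -a_eq0 zz.
  by rewrite a_eq0 mul0r -zt z0 mul0mx mxE.
have {}a_gt0 : 0 < a by rewrite lt_def a_neq0.
rewrite trmxK; set s := (v^T *m v) 0 0.
have := row_sqr_ge0 (z - a *: v^T).
rewrite [(_ - _)^T]linearB /= [(_ *: _)^T]linearZ /= trmxK.
have vz : (v^T *m z^T) 0 0 = t by rewrite -trmx_mul mxE.
rewrite mulmxBl !mulmxBr -!scalemxAl -!scalemxAr !(subE11, scaleE11) zt vz -/s.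
move=> q0; have : a * t <= a * (a * s) by lra.
by rewrite ler_pM2l.
Qed.
End RealSymmetric.

(** * Independent noise *)

Section Independence.
Local Open Scope ereal_scope.
Context d (T : measurableType d) (R : realType) (P : probability T R).
Implicit Types U V : {mfun T >-> R}.

(** By independence on rectangles the law of [(U, V)] is the product of the two laws; integrability
    of the product and the formula then come from iterated integration. *)
Lemma expectation_mul_independent U V :
    (forall A B : set R, measurable A -> measurable B ->
      P (U @^-1` A `&` V @^-1` B) = P (U @^-1` A) * P (V @^-1` B)) ->
    (U : T -> R) \in Lfun P 1 -> (V : T -> R) \in Lfun P 1 ->
  (U \* V)%R \in Lfun P 1 /\ 'E_P[(U \* V)%R] = 'E_P[U] * 'E_P[V].
Proof.
move=> indep /Lfun1_integrable iU /Lfun1_integrable iV.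
pose mZ := measurable_fun_pair (measurable_funPT U) (measurable_funPT V).
pose Z : {mfun T >-> (R * R)%type} := HB.pack (fun w => (U w, V w))
  (isMeasurableFun.Build _ _ _ _ _ mZ).
pose mu := distribution P U \x distribution P V.
have muE (g : R * R -> \bar R) :
    \int[distribution P Z]_z g z = \int[mu]_z g z.
  apply: eq_measure_integral => A mA _; symmetry.
  apply: (product_measure_unique (m1 := distribution P U)
     (m2 := distribution P V) (m' := distribution P Z)) => //.
pose g (z : R * R) := (z.1 * z.2)%:E.
have mmul : measurable_fun setT g.
  by apply/measurable_EFinP; apply: measurable_funM.
have mid : measurable_fun [set: R] (@EFin R) by exact: EFin_measurable.
have iUd : (distribution P U).-integrable setT (@EFin R).
  by apply: integrable_pushforward.
have iVd : (distribution P V).-integrable setT (@EFin R).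
  by apply: integrable_pushforward.
have imu : mu.-integrable setT g.
  apply/integrable12ltyP => //=.
  under eq_integral => x _.
    under eq_integral do rewrite normrM EFinM.
    rewrite ge0_integralZl//; last first.
      by apply/measurable_EFinP; exact: normr_measurable.
    over.
  rewrite ge0_integralZr ?integral_ge0//; last first.
    by apply/measurable_EFinP; exact: normr_measurable.
  move/integrableP : iUd => [_]; move/integrableP : iVd => [_] iV' iU'.
  by rewrite lte_mul_pinfty ?integral_ge0 ?ge0_fin_numE ?integral_ge0.
have iUV : P.-integrable setT (EFin \o (U \* V)%R).
  have : (distribution P Z).-integrable setT g.
    apply/integrableP; split => //; rewrite muE.
    by move/integrableP : imu => [].
  move=> /integrableP [_ h]; apply/integrableP; split.
    by apply/measurable_EFinP; apply: measurable_funM.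
  by move: h; rewrite ge0_integral_distribution//; exact: measurableT_comp.
split; first exact/Lfun1_integrable.
rewrite unlock.
transitivity (\int[distribution P Z]_z g z).
  by rewrite integral_distribution.
rewrite muE -integral12_prod_meas1// /fubini_F /g /=.
under eq_integral => x _.
  under eq_integral do rewrite EFinM.
  rewrite integralZl//; over.
rewrite /= (integral_distribution (X := V))//.
rewrite -(fineK (integrable_fin_num _ iV))// integralZr//.
by rewrite (integral_distribution (X := U)).
Qed.
End Independence.

(** * Sigma-algebras generated by finitely many random variables *)

Section GeneratedSigmaAlgebra.
Context d (T : measurableType d) (R : realType).

Lemma measurable_fun_g_sigma (F : set (set T)) (f : T -> R) :
    F `<=` measurable ->
    measurable_fun [set: g_sigma_algebraType F] (f : g_sigma_algebraType F -> R) ->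
  measurable_fun setT f.
Proof.
move=> FT mf _ B mB; have := mf measurableT B mB.
by apply: smallest_sub; [exact: sigma_algebra_measurable|].
Qed.

(** Generators of the sigma-algebra of the vector [X], chosen so that [<<s preimages X >>] is
    [g_sigma_preimage X] by definition and the independence hypothesis applies as it stands. *)
Definition preimages n (X : 'I_n -> T -> R) : set (set T) :=
  \big[setU/set0]_(i < n) preimage_set_system setT (X i) measurable.

Lemma preimages_measurable n (X : 'I_n -> T -> R) :
  (forall i, measurable_fun setT (X i)) -> preimages X `<=` measurable.
Proof.
move=> mX; apply: (big_ind (fun S : set (set T) => S `<=` measurable)) => //.
  by move=> S1 S2 S1T S2T A [/S1T|/S2T].
by move=> i _ _ [B mB <-]; exact: mX.
Qed.

Lemma measurable_preimages n (X : 'I_n -> T -> R) i :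
  measurable_fun [set: g_sigma_algebraType (preimages X)]
    (X i : g_sigma_algebraType (preimages X) -> R).
Proof.
move=> _ B mB; apply: sub_sigma_algebra.
by rewrite /preimages (bigD1 i)//=; left; exists B.
Qed.

End GeneratedSigmaAlgebra.

(** * Second moment of an affine form in the noise with random coefficients *)

Section UncorrelatedNoise.
Context d (T : measurableType d) (R : realType) (P : probability T R).
Context (n : nat) (eps : 'I_n -> {mfun T >-> R}) (s2 : R) (F : set (set T)).
Hypothesis FT : F `<=` measurable.
Hypothesis eps_indep : forall A B : set T,
  g_sigma_preimage (fun i => eps i : T -> R) A ->
  <<s F >> B -> P (A `&` B) = (P A * P B)%E.
Hypothesis eps_L2 : forall j, (eps j : T -> R) \in Lfun P 2%:E.
Hypothesis eps0 : forall j, ('E_P[eps j] = 0)%E.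
Hypothesis eps_cov : forall j k,
  ('E_P[(eps j \* eps k)%R] = (s2 *+ (j == k))%:E)%E.

Local Notation TF := (g_sigma_algebraType F).
Local Notation TE := (g_sigma_algebraType (preimages (fun i => eps i : T -> R))).

Let epsT : preimages (fun i => eps i : T -> R) `<=` measurable.
Proof. by apply: preimages_measurable => i. Qed.

Let bounded (u : T -> R) := exists K, forall w, `|u w| <= K.

Let bounded_integrable (u : T -> R) :
  measurable_fun setT u -> bounded u -> P.-integrable setT (EFin \o u).
Proof.
move=> mu [K uK]; apply: measurable_bounded_integrable => //.
  exact: (le_lt_trans (probability_le1 P measurableT) (ltry 1)).
exists K; split; first exact: num_real.
by move=> M KM w _; exact: le_trans (uK w) (ltW KM).
Qed.

(** Independence of the sigma-algebra of [F] and that of the noise factorizes the integral;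
    boundedness makes [u] integrable. *)
Let bounded_indep (u v : T -> R) :
    measurable_fun [set: TF] (u : TF -> R) -> bounded u ->
    measurable_fun [set: TE] (v : TE -> R) -> v \in Lfun P 1 ->
  P.-integrable setT (EFin \o (u \* v)) /\
  (\int[P]_w (u w * v w)%:E = \int[P]_w (u w)%:E * 'E_P[v])%E.
Proof.
move=> mu ub mv v1.
pose U : {mfun T >-> R} := HB.pack u
  (isMeasurableFun.Build _ _ _ _ _ (measurable_fun_g_sigma FT mu)).
pose V : {mfun T >-> R} := HB.pack v
  (isMeasurableFun.Build _ _ _ _ _ (measurable_fun_g_sigma epsT mv)).
have [||/Lfun1_integrable uv] := @expectation_mul_independent _ T R P V U _ v1.
- move=> A B mA mB; apply: eps_indep.
    by have := mv measurableT A mA; rewrite setTI.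
  by have := mu measurableT B mB; rewrite setTI.
- apply/Lfun1_integrable/bounded_integrable => //.
rewrite unlock => E; split.
  by rewrite (_ : u \* v = v \* u)//; apply/funext => w /=; rewrite mulrC.
by rewrite muleC -E; apply: eq_integral => w _ /=; rewrite mulrC.
Qed.

(** Boundedness makes every term of the expanded square integrable, so that the integral can be
    split. The terms linear in the noise vanish because it is centered, and only the diagonal of the
    double sum survives by [eps_cov]. *)
Let noise_second_moment_bounded (a : T -> R) (h : 'I_n -> T -> R) :
    measurable_fun [set: TF] (a : TF -> R) -> bounded a ->
    (forall j, measurable_fun [set: TF] (h j : TF -> R)) ->
    (forall j, bounded (h j)) ->
  (\int[P]_w ((a w + \sum_j h j w * eps j w) ^+ 2)%:E =
   \int[P]_w (a w ^+ 2 + s2 * \sum_j h j w ^+ 2)%:E)%E.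
Proof.
move=> ma ba mh bh.
have bM (u v : T -> R) : bounded u -> bounded v ->
    bounded (u \* v).
  move=> [K uK] [L vL]; exists (K * L) => w /=.
  by rewrite normrM ler_pM.
have L1 j : (eps j : T -> R) \in Lfun P 1.
  by rewrite Lfun_subset12 ?fin_num_measure.
have lin j := bounded_indep (measurable_funM ma (mh j)) (bM _ _ ba (bh j))
  (@measurable_preimages _ T R n (fun i => eps i) j) (L1 j).
have quad j k := bounded_indep
  (measurable_funM (mh j) (mh k)) (bM _ _ (bh j) (bh k))
  (measurable_funM (@measurable_preimages _ T R n (fun i => eps i) j)
     (@measurable_preimages _ T R n (fun i => eps i) k))
  (Lfun2_mul_Lfun1 (eps_L2 j) (eps_L2 k)).
have ibd (u : T -> R) : measurable_fun [set: TF] (u : TF -> R) ->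
    bounded u -> P.-integrable setT (EFin \o u).
  by move=> mu bu; apply: bounded_integrable bu; exact: measurable_fun_g_sigma mu.
have ia := ibd _ (measurable_funM ma ma) (bM _ _ ba ba).
have ih j := ibd _ (measurable_funM (mh j) (mh j)) (bM _ _ (bh j) (bh j)).
transitivity (\int[P]_w ((a w * a w)%:E +
   (\sum_j (2%:E * (a w * h j w * eps j w)%:E) +
    \sum_j \sum_k (h j w * h k w * (eps j w * eps k w))%:E)))%E.
  apply: eq_integral => w _; under [X in (_ + (X + _))%E]eq_bigr do rewrite -EFinM.
  under [X in (_ + (_ + X))%E]eq_bigr do rewrite sumEFin.
  rewrite !sumEFin -!EFinD; congr EFin.
  rewrite sqrrD expr2 -addrA; congr (_ + (_ + _)).
    rewrite mulr_sumr -mulr_natl mulr_sumr; apply: eq_bigr => j _; ring.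
  rewrite expr2 mulr_suml; apply: eq_bigr => j _; rewrite mulr_sumr.
  by apply: eq_bigr => k _; ring.
have ilin : P.-integrable setT
    (fun w => \sum_j (2%:E * (a w * h j w * eps j w)%:E))%E.
  by apply: integrable_sum => // j _; apply: integrableZl => //; exact: (lin j).1.
have iquad : P.-integrable setT
    (fun w => \sum_j \sum_k (h j w * h k w * (eps j w * eps k w))%:E)%E.
  apply: integrable_sum => // j _; apply: integrable_sum => // k _.
  exact: (quad j k).1.
rewrite integralD//; last exact: integrableD.
rewrite integralD// integral_sum//; last first.
  by move=> j; apply: integrableZl => //; exact: (lin j).1.
rewrite big1 ?add0e; last first.
  by move=> j _; rewrite integralZl ?(lin j).2 ?eps0 ?mule0//; exact: (lin j).1.
rewrite integral_sum//; last first.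
  by move=> j; apply: integrable_sum => // k _; exact: (quad j k).1.
under [RHS]eq_integral do rewrite EFinD mulr_sumr -sumEFin.
rewrite integralD//; last first.
  apply: integrable_sum => // j _.
  by under eq_fun do rewrite EFinM; apply: integrableZl => //; exact: ih.
congr (_ + _)%E.
rewrite integral_sum//; last first.
  by move=> j; under eq_fun do rewrite EFinM; apply: integrableZl => //; exact: ih.
apply: eq_bigr => j _.
rewrite integral_sum//; last by move=> k; exact: (quad j k).1.
rewrite (bigD1 j)//= big1 ?adde0; last first.
  by move=> k kj; rewrite (quad j k).2 eps_cov eq_sym (negbTE kj) mule0.
rewrite (quad j j).2 eps_cov eqxx mulr1n muleC -integralZl//; last exact: ih.
Qed.

(** Truncation removes the boundedness assumption. The bounded case applies on the events [D k],
    which belong to the sigma-algebra of [F]; both integrands are nonnegative, so monotone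
    convergence gives the identity, possibly between infinite values. *)
Lemma noise_second_moment (a : T -> R) (h : 'I_n -> T -> R) :
    measurable_fun [set: TF] (a : TF -> R) ->
    (forall j, measurable_fun [set: TF] (h j : TF -> R)) -> 0 <= s2 ->
  (\int[P]_w ((a w + \sum_j h j w * eps j w) ^+ 2)%:E =
   \int[P]_w (a w ^+ 2 + s2 * \sum_j h j w ^+ 2)%:E)%E.
Proof.
move=> ma mh s20.
(* [s] dominates [a] and every [h j], so one event [D k] bounds them all by [k]. *)
pose s w := `|a w| + \sum_j `|h j w|.
have ms : measurable_fun [set: TF] (s : TF -> R).
  apply: measurable_funD; first exact: measurableT_comp.
  by apply: measurable_sum => j; exact: measurableT_comp.
pose D k := [set w | s w <= k%:R].
have mDF k : measurable (D k : set TF).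
  by rewrite -[X in measurable X]setTI; exact: measurable_fun_le.
have mD k : measurable (D k).
  have := mDF k.
  by apply: smallest_sub; [exact: sigma_algebra_measurable|].
have Dnd : nondecreasing_seq D.
  move=> k l kl; apply/subsetPset => w; rewrite /D /= => /le_trans; apply.
  by rewrite ler_nat.
have DT : \bigcup_k D k = setT.
  apply/seteqP; split => // w _; exists (Num.truncn (s w)).+1 => //.
  by rewrite /D /= ltW// truncnS_gt.
have maT := measurable_fun_g_sigma FT ma.
have mhT j := measurable_fun_g_sigma FT (mh j).
have trunc k (u v : T -> R) : (forall w, u w * \1_(D k) w = v w) ->
    (\int[P]_(w in D k) (u w)%:E = \int[P]_w (v w)%:E)%E.
  move=> uv; rewrite integral_mkcond; apply: eq_integral => w _ /=.
  rewrite -uv patchE indicE; case: (w \in D k); by rewrite ?mulr1 ?mulr0.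
have eqD k : (\int[P]_(w in D k) ((a w + \sum_j h j w * eps j w) ^+ 2)%:E =
    \int[P]_(w in D k) (a w ^+ 2 + s2 * \sum_j h j w ^+ 2)%:E)%E.
  (* The form is linear in [a] and [h]: multiplying them by the indicator of [D k] leaves the
     integrand unchanged on [D k] and makes it 0 outside. *)
  rewrite (trunc k _ (fun w => (a w * \1_(D k) w +
     \sum_j h j w * \1_(D k) w * eps j w) ^+ 2)); last first.
    move=> w; under [in RHS]eq_bigr do rewrite mulrAC.
    rewrite -mulr_suml -mulrDl exprMn indicE.
    by case: (w \in D k); rewrite ?expr1n ?expr0n.
  have indM (u : T -> R) : measurable_fun [set: TF] (u : TF -> R) ->
      measurable_fun [set: TF] (u \* \1_(D k) : TF -> R).
    by move=> mu; apply: measurable_funM => //; exact: measurable_indic.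
  have indB (u : T -> R) : (forall w, `|u w| <= s w) -> bounded (u \* \1_(D k)).
    move=> us; exists k%:R => w /=; rewrite indicE.
    case: (boolP (w \in D k)) => [|_]; last by rewrite mulr0 normr0.
    by rewrite inE mulr1; exact: le_trans.
  rewrite (noise_second_moment_bounded (indM _ ma) _ (fun j => indM _ (mh j))).
  - apply/esym/trunc => w /=; have : \1_(D k) w = (w \in D k)%:R :> R.
      by rewrite indicE.
    case: (w \in D k) => e; rewrite e ?mulr1 ?mulr0 ?expr0n/=.
      by congr (_ + _ * _); apply: eq_bigr => j _; rewrite mulr1.
    by rewrite big1 ?mulr0 ?addr0// => j _; rewrite mulr0 expr0n.
  - by apply: indB => w; rewrite lerDl sumr_ge0.
  - move=> j; apply: indB => w; rewrite /s (bigD1 j)//= addrCA lerDl.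
    by rewrite addr_ge0// sumr_ge0.
rewrite -DT.
have cvg1 : (\int[P]_(w in D k) ((a w + \sum_j h j w * eps j w) ^+ 2)%:E
    @[k --> \oo] --> \int[P]_(w in \bigcup_k D k)
       ((a w + \sum_j h j w * eps j w) ^+ 2)%:E)%E.
  apply: ge0_nondecreasing_set_cvg_integral => //.
    move=> k; apply/measurable_EFinP; apply: measurable_funX.
    apply: measurable_funTS; apply: measurable_funD => //.
    by apply: measurable_sum => j; exact: measurable_funM.
  by move=> k w _; rewrite lee_fin sqr_ge0.
suff cvg2 : (\int[P]_(w in D k) (a w ^+ 2 + s2 * \sum_j h j w ^+ 2)%:E
    @[k --> \oo] --> \int[P]_(w in \bigcup_k D k)
       (a w ^+ 2 + s2 * \sum_j h j w ^+ 2)%:E)%E.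
  rewrite -(cvg_lim _ cvg1)// -(cvg_lim _ cvg2)//.
  by congr (lim (_ @ \oo)); apply/funext.
apply: ge0_nondecreasing_set_cvg_integral => //.
  move=> k; apply/measurable_EFinP; apply: measurable_funTS.
  apply: measurable_funD; first exact: measurable_funX.
  apply: measurable_funM => //.
  by apply: measurable_sum => j; exact: measurable_funX.
move=> k w _; rewrite lee_fin addr_ge0 ?sqr_ge0 ?mulr_ge0 ?sumr_ge0// => j _.
by rewrite sqr_ge0.
Qed.
End UncorrelatedNoise.

(** * Integration by parts and projections on an interval *)

Section IntervalEnds.
Context {R : realType}.
Implicit Types (I : set R) (g : R -> R) (c l x : R).

Local Notation einf I := (ereal_inf [set x%:E | x in I]).
Local Notation esup I := (ereal_sup [set x%:E | x in I]).

(** Witnesses: [c - k] when [inf I = -oo], and [r + (c - r) / (k + 1)] when [inf I] is a real [r].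
    They turn limits along [near_inf] into limits of sequences. *)
Lemma near_inf_seq I c : (einf I < c%:E)%E ->
  exists u : R^nat, [/\ forall k, (einf I < (u k)%:E)%E /\ u k <= c,
    forall x, (einf I < x%:E)%E -> \forall k \near \oo, u k < x
  & forall g l, g @ near_inf I --> l -> g (u k) @[k --> \oo] --> l].
Proof.
rewrite /near_inf; case: (einf I) => [r||] rc; last 2 first.
- by rewrite ltNge leey in rc.
- exists (fun k => c - k%:R).
  have uNy : c - k%:R @[k --> \oo] --> -oo.
    apply/cvgrNyPle => A; near=> k; rewrite lerBlDl -lerBlDr.
    near: k; exact: nbhs_infty_ger.
  split => [k|x _|g l /cvg_ninftyP]; last exact.
    by rewrite ltNyr gerBl ler0n.
  by move/cvgrNy_lt : uNy; apply.
- rewrite lte_fin in rc; exists (fun k => r + (c - r) * harmonic k).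
  have ur : r + (c - r) * harmonic k @[k --> \oo] --> r.
    rewrite -[X in _ --> X]addr0 -[X in _ --> _ + X](mulr0 (c - r)).
    apply: cvgD; first exact: cvg_cst.
    by apply: cvgM; [exact: cvg_cst|exact: cvg_harmonic].
  have rpos k : r < r + (c - r) * harmonic k.
    by rewrite ltrDl mulr_gt0 ?subr_gt0// invr_gt0.
  split => [k|x|g l /cvg_at_rightP]; last by apply.
    rewrite lte_fin rpos; split => //; rewrite -lerBrDl ger_pMr ?subr_gt0//.
    by rewrite invf_le1// ler1n.
  by rewrite lte_fin => rx; exact: cvgr_lt ur _ rx.
Unshelve. all: by end_near. Qed.

Lemma near_sup_seq I c : (c%:E < esup I)%E ->
  exists u : R^nat, [/\ forall k, ((u k)%:E < esup I)%E /\ c <= u k,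
    forall x, (x%:E < esup I)%E -> \forall k \near \oo, x < u k
  & forall g l, g @ near_sup I --> l -> g (u k) @[k --> \oo] --> l].
Proof.
rewrite /near_sup; case: (esup I) => [r||] rc; last 2 first.
- exists (fun k => c + k%:R).
  have uy : c + k%:R @[k --> \oo] --> +oo.
    apply/cvgryPge => A; near=> k; rewrite -lerBlDl.
    near: k; exact: nbhs_infty_ger.
  split => [k|x _|g l /cvg_pinftyP]; last exact.
    by rewrite ltry lerDl ler0n.
  by move/cvgry_gt : uy; apply.
- by rewrite ltNge leNye in rc.
- rewrite lte_fin in rc; exists (fun k => r - (r - c) * harmonic k).
  have ur : r - (r - c) * harmonic k @[k --> \oo] --> r.
    rewrite -[X in _ --> X]subr0 -[X in _ --> _ - X](mulr0 (r - c)).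
    apply: cvgB; first exact: cvg_cst.
    by apply: cvgM; [exact: cvg_cst|exact: cvg_harmonic].
  have rpos k : r - (r - c) * harmonic k < r.
    by rewrite gtrBl mulr_gt0 ?subr_gt0// invr_gt0.
  split => [k|x|g l /cvg_at_leftP]; last by apply.
    rewrite lte_fin rpos; split => //; rewrite lerBrDl -lerBrDr ger_pMr ?subr_gt0//.
    by rewrite invf_le1// ler1n.
  by rewrite lte_fin => rx; exact: cvgr_gt ur _ rx.
Unshelve. all: by end_near. Qed.

(** For an interval this is the interior; comparing with the extended ends treats bounded and
    unbounded intervals alike. *)
Definition inner I : set R := [set x | (einf I < x%:E < esup I)%E].

Lemma inner_between I x : inner I x -> exists y z, [/\ I y, I z & y < x < z].
Proof.
move=> /andP[/ereal_inf_lt[_ [y Iy <-] yx]].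
move=> /ereal_sup_gt[_ [z Iz <-] xz].
by rewrite !lte_fin in yx xz; exists y, z; rewrite yx.
Qed.

Lemma inner_sub I : is_interval I -> inner I `<=` I.
Proof.
move=> itvI x /inner_between[y [z [Iy Iz /andP[yx xz]]]].
by apply: (itvI y z) => //; rewrite !ltW.
Qed.

Lemma inner_nbhs I x : inner I x -> \forall y \near x, inner I y.
Proof.
move=> /inner_between[y [z [Iy Iz /andP[yx xz]]]].
near=> t; apply/andP; split.
  apply: (@le_lt_trans _ _ y%:E); first by apply: ereal_inf_lbound; exists y.
  by rewrite lte_fin; near: t; exact: lt_nbhsr.
apply: (@lt_le_trans _ _ z%:E); last by apply: ereal_sup_ubound; exists z.
by rewrite lte_fin; near: t; exact: lt_nbhsl.
Unshelve. all: by end_near. Qed.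

Lemma inner_itv I u v : inner I u -> inner I v -> `[u, v] `<=` inner I.
Proof.
move=> /andP[u1 _] /andP[_ v1] x /=; rewrite in_itv /= => /andP[ux xv].
by apply/andP; split; [apply: lt_le_trans u1 _|apply: le_lt_trans v1];
  rewrite lee_fin.
Qed.

(** [fine] sends an infinite end to 0, so the pair on the right may contain a real number that is
    not an end; the pair is a null set in all cases. *)
Lemma subset_inner_ends I :
  I `<=` inner I `|` [set fine (einf I); fine (esup I)].
Proof.
move=> x Ix; rewrite /inner /=.
have ax : (einf I <= x%:E)%E by apply: ereal_inf_lbound; exists x.
have xb : (x%:E <= esup I)%E by apply: ereal_sup_ubound; exists x.
move: ax; rewrite le_eqVlt => /orP[/eqP ->|ax]; first by right; left.
move: xb; rewrite le_eqVlt => /orP[/eqP <-|xb]; first by right; right.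
by left; rewrite ax xb.
Qed.

Lemma ends_negligible I :
  (@lebesgue_measure R).-negligible [set fine (einf I); fine (esup I)].
Proof.
apply: negligibleU; apply/negligibleP; try exact: measurable_set1.
  exact: lebesgue_measure_set1.
exact: lebesgue_measure_set1.
Qed.

(** If the interior were empty, [I] would lie in a set of at most two points and be null. [c2] is
    the midpoint of [c1] and a point of [I] beyond it. *)
Lemma inner_pair I : is_interval I -> lebesgue_measure I != 0%E -> exists c1 c2,
  [/\ inner I c1, inner I c2 & c1 < c2].
Proof.
move=> itvI I0; have [c1 Ic1] : inner I !=set0.
  apply/set0P; apply: contra_neq I0 => I0.
  have := @subset_inner_ends I; rewrite I0 set0U => Isub.
  have : (@lebesgue_measure R).-negligible I.
    exact (@negligibleS _ _ _ (@lebesgue_measure R) _ _ Isub (ends_negligible I)).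
  by move/negligibleP; apply; exact: is_interval_measurable.
have [y [z [Iy Iz /andP[yc cz]]]] := inner_between Ic1.
have [c1m mz] := midf_lt cz.
exists c1, ((c1 + z) / 2); split => //; apply/andP; split.
  move: Ic1 => /andP[/lt_trans + _]; apply; by rewrite lte_fin.
apply: (@lt_le_trans _ _ z%:E); first by rewrite lte_fin.
by apply: ereal_sup_ubound; exists z.
Qed.

(** The fundamental theorem of calculus on segments [[u k, v k]] that exhaust the interior gives
    [g (v k) - g (u k)]. Dominated convergence by [|g'|] sends the integrals to the one over [I],
    and the differences tend to [l - l = 0]. *)
Lemma integral_derive_eq0 I g g' : is_interval I ->
    lebesgue_measure I != 0%E ->
    (forall x, inner I x -> is_derive x 1 g (g' x)) ->
    (forall x, inner I x -> {for x, continuous g'}) ->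
    (@lebesgue_measure R).-integrable I (EFin \o g') ->
    equal_boundary_values I g ->
  (\int[@lebesgue_measure R]_(x in I) (g' x)%:E = 0)%E.
Proof.
move=> itvI I0 dg cg' ig' [l [ginf gsup]].
(* Keeping [u k] below [c1] and [v k] above [c2] ensures [u k < v k] for every [k]. *)
have [c1 [c2 [/andP[c1a c1b] /andP[c2a c2b] c12]]] := inner_pair itvI I0.
have [u [uc u_lt /(_ _ _ ginf) gu]] := near_inf_seq c1a.
have [v [vc v_gt /(_ _ _ gsup) gv]] := near_sup_seq c2b.
have uv k : u k < v k.
  by rewrite (le_lt_trans (uc k).2)// (lt_le_trans c12)// (vc k).2.
have Iu k : inner I (u k).
  apply/andP; split; first exact: (uc k).1.
  by rewrite (le_lt_trans _ c1b)// lee_fin (uc k).2.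
have Iv k : inner I (v k).
  apply/andP; split; last exact: (vc k).1.
  by rewrite (lt_le_trans c2a)// lee_fin (vc k).2.
have mI : measurable I by exact: is_interval_measurable.
have FTC k : (\int[lebesgue_measure]_(x in `[u k, v k]) (g' x)%:E =
    (g (v k) - g (u k))%:E)%E.
  have sub := inner_itv (Iu k) (Iv k).
  have gcont x : inner I x -> {for x, continuous g}.
    by move=> /dg [dx _]; apply/differentiable_continuous/derivable1_diffP.
  rewrite (@continuous_FTC2 _ _ g)//.
  - apply: continuous_in_subspaceT => x; rewrite inE => xuv.
    by apply: cg'; exact: sub.
  - split.
    + move=> x /subset_itv_oo_cc xuv.
      by have [] := dg x (sub x xuv).
    + by apply: cvg_at_right_filter; exact: gcont.
    + by apply: cvg_at_left_filter; exact: gcont.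
  - move=> x /subset_itv_oo_cc xuv; rewrite derive1E.
    by have [_ ] := dg x (sub x xuv).
pose h k := (EFin \o g') \_ `[u k, v k]%classic.
have hint k : (\int[lebesgue_measure]_(x in I) h k x = (g (v k) - g (u k))%:E)%E.
  rewrite -integral_mkcondr setIidr ?FTC//.
  by apply: subset_trans (inner_sub itvI); exact: inner_itv.
have mg' : measurable_fun I (EFin \o g').
  by move/integrableP : ig' => [].
have mh k : measurable_fun I (h k).
  apply/measurable_restrict => //; apply: measurable_funS mg' => //.
(* An interior point eventually lies in [[u k, v k]]; the ends form a null set. *)
have hg' : {ae lebesgue_measure, forall x, I x ->
    h k x @[k --> \oo] --> (EFin \o g') x}.
  apply: (negligibleS _ (ends_negligible I)) => x /=.
  apply: contra_notP => xends Ix.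
  have [/andP[ax xb]|//] := subset_inner_ends Ix.
  apply: cvg_near_cst; near=> k; rewrite /h patchE mem_set//=.
  rewrite in_itv /= !ltW//; near: k; [exact: v_gt|exact: u_lt].
have hb : {ae lebesgue_measure, forall x k, I x -> (`|h k x| <= `|(g' x)%:E|)%E}.
  apply/aeW => x k _; rewrite /h patchE; case: ifP => // _.
  by rewrite abse0 abse_ge0.
have iabs : (@lebesgue_measure R).-integrable I (fun x => `|(g' x)%:E|%E).
  exact: integrable_abse.
have [_ _] := dominated_convergence (mu := @lebesgue_measure R)
  mI mh mg' hg' iabs hb.
rewrite [X in X @ \oo](_ : _ = (fun k => (g (v k) - g (u k))%:E)); last first.
  by apply/funext => k; rewrite /= hint.
move=> lim1; apply: (cvg_unique _ lim1) => //.
rewrite (_ : 0%E = (l - l)%:E); last by rewrite subrr.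
apply: cvg_EFin; first by near=> k.
by apply: cvgB.
Unshelve. all: by end_near. Qed.
End IntervalEnds.

(** * Square integrable functions on [I]: inner product and best approximation *)

Section L2Space.
Context {R : realType} (I : set R).
Hypothesis mI : measurable I.
Local Notation mu := (@lebesgue_measure R).
Implicit Types (f g h : R -> R).

Lemma L2_mul_integrable f g : L2 I f -> L2 I g ->
  mu.-integrable I (EFin \o (f \* g)).
Proof.
move=> f2 g2; apply/(@integrable_mkcond _ _ _ mu _ _ mI).
have /Lfun1_integrable := Lfun2_mul_Lfun1 f2 g2.
congr (_.-integrable _ _); apply/funext => x /=; rewrite !patchE.
by case: ifP => //=; rewrite mulr0.
Qed.

Lemma L2_linear c f g : L2 I f -> L2 I g -> L2 I (fun x => c * f x + g x).
Proof.
move=> f2 g2; rewrite /L2.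
have -> : (fun x => c * f x + g x) \_ I = c *: (f \_ I) + g \_ I.
  apply/funext => x; rewrite !fctE !patchE; case: ifP => //.
  by rewrite scaler0 addr0.
exact: ((Lfun_submod_closed mu (lee1n 2)).2 c _ _ f2 g2).
Qed.

Lemma L2_sum k (c : 'I_k -> R) (h : 'I_k -> R -> R) : (forall j, L2 I (h j)) ->
  L2 I (fun x => \sum_j c j * h j x).
Proof.
move=> h2; elim: k c h h2 => [|k IH] c h h2.
  rewrite (_ : (fun _ => _) = cst 0); last first.
    by apply/funext => x; rewrite big_ord0.
  rewrite /L2 (_ : _ \_ I = 0); first exact: (Lfun_submod_closed mu (lee1n 2)).1.
  by apply/funext => x; rewrite patchE; case: ifP.
under eq_fun do rewrite big_ord_recl; apply: L2_linear => //.
exact: (IH (fun j => c (lift ord0 j))).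
Qed.

Lemma L2B f g : L2 I f -> L2 I g -> L2 I (f \- g).
Proof.
move=> f2 g2; rewrite (_ : f \- g = (fun x => -1 * g x + f x)).
  exact: L2_linear.
by apply/funext => x /=; rewrite mulN1r addrC.
Qed.

Lemma L2innerC f g : L2inner I f g = L2inner I g f.
Proof. by apply: eq_Rintegral => x _; rewrite mulrC. Qed.

Lemma L2inner_linear c f g h : L2 I f -> L2 I g -> L2 I h ->
  L2inner I (fun x => c * f x + g x) h = c * L2inner I f h + L2inner I g h.
Proof.
move=> f2 g2 h2; have fh := L2_mul_integrable f2 h2.
rewrite /L2inner -RintegralZl// -RintegralD//.
- by apply: eq_Rintegral => x _ /=; rewrite mulrDl mulrA.
- exact: (integrableZl (mu := mu) mI c fh).
- exact: L2_mul_integrable.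
Qed.

Lemma L2inner_sum k (c : 'I_k -> R) (f : 'I_k -> R -> R) h :
    (forall j, L2 I (f j)) -> L2 I h ->
  L2inner I (fun x => \sum_j c j * f j x) h = \sum_j c j * L2inner I (f j) h.
Proof.
move=> f2 h2; elim: k c f f2 => [|k IH] c f f2.
  rewrite big_ord0 /L2inner (@eq_Rintegral _ _ _ mu I (cst 0)).
    by rewrite Rintegral_cst ?mul0r.
  by move=> x _; rewrite /= big_ord0 mul0r.
rewrite big_ord_recl -(IH (fun j => c (lift ord0 j)))//.
rewrite -L2inner_linear//; last exact: L2_sum.
by apply: eq_Rintegral => x _; rewrite big_ord_recl.
Qed.

Lemma L2innerBl f g h : L2 I f -> L2 I g -> L2 I h ->
  L2inner I (f \- g) h = L2inner I f h - L2inner I g h.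
Proof.
move=> f2 g2 h2; rewrite -[RHS]addrC -mulN1r -L2inner_linear//.
by apply: eq_Rintegral => x _ /=; rewrite mulN1r addrC.
Qed.

Lemma sqr_L2norm f : (L2norm I f ^+ 2 = \int[mu]_(x in I) (f x ^+ 2)%:E)%E.
Proof.
have sqrE (x : \bar R) : (0 <= x -> x ^+ 2 = x `^ 2)%E.
  move=> x0; rewrite -[2%R in RHS]/(1 + 1)%R poweRD ?poweRe1//.
  by rewrite add_neq0_poweRD_def// pnatr_eq0.
rewrite sqrE ?Lnorm_ge0// /L2norm poweR_Lnorm ?pnatr_eq0//.
rewrite [RHS]integral_mkcond; apply: eq_integral => x _ /=.
rewrite !patchE; case: ifP => _ /=.
  by rewrite powR_mulrn// real_normK ?num_real.
by rewrite normr0 powR_mulrn// expr0n.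
Qed.

Lemma sqr_L2norm_inner f : L2 I f -> (L2norm I f ^+ 2 = (L2inner I f f)%:E)%E.
Proof.
move=> f2; rewrite sqr_L2norm /L2inner /Rintegral fineK; last first.
  by apply: integrable_fin_num => //; exact: L2_mul_integrable.
by apply: eq_integral => x _; rewrite expr2.
Qed.

Lemma L2inner_ge0 f : 0 <= L2inner I f f.
Proof. by apply: Rintegral_ge0 => x _; rewrite -expr2 sqr_ge0. Qed.

(** Pythagoras: [t - g = (t - q) + (q - g)], where [t - q] lies in [S] and is therefore orthogonal
    to [q - g]. *)
Lemma orth_proj_minimizes (S : set (R -> R)) g q t :
    L2 I g -> (forall s, S s -> L2 I s) ->
    (forall s s', S s -> S s' -> S (s \- s')) ->
    is_orth_proj I S g q -> S t ->
  (L2norm I (q \- g)%R ^+ 2 <= L2norm I (t \- g)%R ^+ 2)%E.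
Proof.
move=> g2 S2 SB [Sq qperp] St.
have q2 := S2 _ Sq; have t2 := S2 _ St.
have tq2 := L2B t2 q2; have qg2 := L2B q2 g2; have gq2 := L2B g2 q2.
have perp := qperp _ (SB _ _ St Sq).
rewrite !sqr_L2norm_inner ?lee_fin; [|exact: L2B|exact: L2B].
have -> : L2inner I (t \- g) (t \- g) =
    L2inner I (t \- q) (t \- q) + L2inner I (q \- g) (q \- g).
  have E : t \- g = (fun x => 1 * (t \- q) x + (q \- g) x).
    by apply/funext => x /=; ring.
  have perp' : L2inner I (q \- g) (t \- q) = 0.
    move: perp; rewrite !L2innerBl//; lra.
  rewrite {1}E L2inner_linear//; last exact: L2B.
  rewrite mul1r (L2innerC (t \- q)) (L2innerC (q \- g)) E.
  rewrite !L2inner_linear// mul1r perp' (L2innerC (t \- q) (q \- g)) perp'.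
  ring.
by rewrite lerDr L2inner_ge0.
Qed.

End L2Space.

(** * Derivatives relative to [I], integration by parts and Fourier coefficients *)

Section IntegrationByParts.
Context {R : realType} (I : set R).
Hypothesis itvI : is_interval I.
Local Notation mu := (@lebesgue_measure R).
Implicit Types (b g : R -> R).

(** A whole neighborhood of an interior point lies in [I], so the limit of the relative difference
    quotient is the ordinary derivative. *)
Lemma derive_on_inner g x : derivable_on I g -> inner I x ->
  is_derive x 1 g (derive_on I g x).
Proof.
move=> dg inx; have Ix := inner_sub itvI inx.
have := dg x Ix; rewrite /derive_on patchE mem_set//.
set q := fun y => _; set l := lim _ => ql.
suff ql0 : h^-1 *: ((g \o shift x) (h *: (1 : R)) - g x) @[h --> 0^'] --> l.
  apply: DeriveDef; first by apply/cvg_ex; exists l.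
  exact/cvg_lim.
have {}ql : q @ within I x^' --> l by [].
have shift_cvg : h + x @[h --> 0^'] --> within I x^'.
  move=> A xA; have : \forall y \near x, y != x -> A y.
    near=> y => yx; have : y != x -> I y -> A y by near: y; exact: xA.
    apply => //; apply: inner_sub => //; near: y; exact: inner_nbhs.
  rewrite (near_shift 0) subr0; apply: filterS => h /= Ahx h0; apply: Ahx.
  by rewrite -subr_eq0 addrK.
rewrite (_ : (fun _ => _) = q \o (fun h => h + x)).
  exact: cvg_comp ql.
apply/funext => h /=; rewrite /q addrK [h *: 1]mulr1 mulrC//.
Unshelve. all: by end_near. Qed.

Lemma derivable_on_continuous g x : derivable_on I g -> inner I x ->
  {for x, continuous g}.
Proof.
move=> dg inx; have [dx _] := derive_on_inner dg inx.
exact/differentiable_continuous/derivable1_diffP.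
Qed.

(** [(b g)' = b' g + b g'] is continuous on the interior, and integrable as a sum of products of
    square integrable functions; equal boundary values of [b g] make its integral 0. *)
Lemma L2inner_by_parts b g : mu I != 0%E ->
    (forall x, derivable b x 1) -> continuous (derive1 b) -> derivable_on I g ->
    (forall x, inner I x -> {for x, continuous (derive_on I g)}) ->
    L2 I b -> L2 I (derive1 b) -> L2 I g -> L2 I (derive_on I g) ->
    equal_boundary_values I (b \* g) ->
  L2inner I (derive1 b) g = - L2inner I b (derive_on I g).
Proof.
move=> I0 db cb' dg cg' b2 b'2 g2 g'2 bv.
have mI := is_interval_measurable itvI.
have i1 := L2_mul_integrable mI b'2 g2.
have i2 := L2_mul_integrable mI b2 g'2.
pose h x := derive1 b x * g x + b x * derive_on I g x.
have cb x : {for x, continuous b}.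
  exact/differentiable_continuous/derivable1_diffP.
have := @integral_derive_eq0 R I (b \* g) h itvI I0 _ _ _ bv.
suff ->: (\int[mu]_(x in I) (h x)%:E =
   (L2inner I (derive1 b) g + L2inner I b (derive_on I g))%:E)%E.
  move=> E; apply/eqP; rewrite -addr_eq0; apply/eqP/EFin_inj; apply: E.
  - move=> x inx; rewrite /h.
    have db' : is_derive x 1 b (derive1 b x) by apply: DeriveDef; rewrite ?derive1E.
    apply: is_derive_eq (is_deriveM db' (derive_on_inner dg inx)) _.
    by rewrite addrC; congr (_ + _); exact: mulrC.
  - move=> x inx; apply: cvgD; apply: cvgM => //.
    + exact: cb'.
    + exact: derivable_on_continuous.
    + exact: cb.
    + exact: cg'.
  - exact: (integrableD (mu := mu) mI i1 i2).
rewrite EFinD /L2inner /Rintegral !fineK ?integrable_fin_num//.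
by rewrite -(integralD (mu := mu) mI i1 i2).
Qed.

(** Orthonormality: testing the residual against [phi j] forces the coefficient, and conversely a
    residual orthogonal to the first [k] basis functions is orthogonal to their span. *)
Lemma orth_proj_coef (phi : nat -> R -> R) k (d : 'I_k -> R) g :
    hilbert_basis I phi -> L2 I g ->
    is_orth_proj I (Sspan phi k) g (fun x => \sum_j d j * phi j x) <->
  (forall j, d j = L2inner I g (phi j)).
Proof.
move=> [phi2 orth _] g2; have mI := is_interval_measurable itvI.
have coef (c : 'I_k -> R) (j : 'I_k) :
    L2inner I (fun x => \sum_i c i * phi i x) (phi j) = c j.
  rewrite L2inner_sum//.
  rewrite (bigD1 j)//= orth eqxx mulr1 big1 ?addr0// => i ij.
  by rewrite orth (inj_eq val_inj) (negbTE ij) mulr0.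
have s2 (c : 'I_k -> R) : L2 I (fun x => \sum_i c i * phi i x) by exact: L2_sum.
split=> [[_ perp] j|dE].
  have : L2inner I (g \- (fun x => \sum_i d i * phi i x)) (phi j) = 0.
    apply: perp; exists (fun i => (i == j)%:R) => //.
    apply/funext => x; rewrite (bigD1 j)//= eqxx mul1r big1 ?addr0// => i ij.
    by rewrite (negbTE ij) mul0r.
  by rewrite L2innerBl// coef; lra.
split; first by exists d.
move=> _ [c _ <-]; rewrite L2innerC L2inner_sum//; last exact: L2B.
apply: big1 => j _; rewrite L2innerC L2innerBl// coef dE subrr mulr0//.
Qed.
End IntegrationByParts.

(** * Measurability of random matrices and integrals against a bounded density *)

Section MeasurableMatrix.
Context d (T : measurableType d) (R : realType).

Definition measurable_mx n k (M : T -> 'M[R]_(n, k)) :=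
  forall i j, measurable_fun setT (fun w => M w i j).

Lemma measurable_mulmx n k l (M : T -> 'M[R]_(n, k)) (N : T -> 'M[R]_(k, l)) :
  measurable_mx M -> measurable_mx N -> measurable_mx (fun w => M w *m N w).
Proof.
move=> mM mN i j; under eq_fun do rewrite mxE.
by apply: measurable_sum => e; exact: measurable_funM.
Qed.

Lemma measurable_trmx n k (M : T -> 'M[R]_(n, k)) :
  measurable_mx M -> measurable_mx (fun w => (M w)^T).
Proof. by move=> mM i j; under eq_fun do rewrite mxE; exact: mM. Qed.

Lemma measurable_scalemx n k c (M : T -> 'M[R]_(n, k)) :
  measurable_mx M -> measurable_mx (fun w => c *: M w).
Proof.
by move=> mM i j; under eq_fun do rewrite mxE; exact: measurable_funM.
Qed.

Lemma measurable_oppmx n k (M : T -> 'M[R]_(n, k)) :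
  measurable_mx M -> measurable_mx (fun w => - M w).
Proof.
by move=> mM i j; under eq_fun do rewrite mxE; exact: measurable_funN.
Qed.

Lemma measurable_cst_mx n k (M : 'M[R]_(n, k)) : measurable_mx (fun=> M).
Proof. by move=> i j; exact: measurable_cst. Qed.

Lemma measurable_det n (M : T -> 'M[R]_n) :
  measurable_mx M -> measurable_fun setT (fun w => \det (M w)).
Proof.
move=> mM; apply: measurable_sum => s; apply: measurable_funM => //.
by apply: measurable_prod => i _; exact: mM.
Qed.

(** The inverse is [f] times a real power of the nonnegative [f ^+ 2]; at the zeros of [f] both
    sides are 0 because [0^-1 = 0]. *)
Lemma measurable_fun_inv (f : T -> R) : measurable_fun setT f ->
  measurable_fun setT (fun w => (f w)^-1).
Proof.
move=> mf; rewrite (_ : (fun _ => _) = (fun w => f w * (f w ^+ 2) `^ (- 1))).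
  apply: measurable_funM => //.
  apply: (@measurableT_comp _ _ _ _ _ _ (@powR R ^~ (-1))).
    exact: measurable_powR.
  exact: measurable_funX.
apply/funext => w; rewrite powR_inv1 ?sqr_ge0// expr2 invfM.
have [->|f0] := eqVneq (f w) 0; first by rewrite invr0 mul0r.
by rewrite mulrA divff// mul1r.
Qed.

(** Cofactor formula; [invmx] returns a singular matrix unchanged, hence the second branch. *)
Lemma measurable_invmx n (M : T -> 'M[R]_n) :
  measurable_mx M -> measurable_mx (fun w => invmx (M w)).
Proof.
move=> mM i j; rewrite (_ : (fun _ => _) = (fun w => if \det (M w) != 0
    then (\det (M w))^-1 * cofactor (M w) j i else M w i j)); last first.
  apply/funext => w; rewrite /invmx unitmxE unitfE.
  by case: ifP => //; rewrite !mxE.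
apply: measurable_fun_ifT.
- apply: measurable_neg; apply: measurable_fun_eqr => //; exact: measurable_det.
- apply: measurable_funM; first exact/measurable_fun_inv/measurable_det.
  apply: measurable_funM => //; apply: measurable_det => k l.
  by under eq_fun do rewrite !mxE; exact: mM.
- exact: mM.
Qed.

Lemma measurable_mxtrace n (M : T -> 'M[R]_n) :
  measurable_mx M -> measurable_fun setT (fun w => \tr (M w)).
Proof. by move=> mM; apply: measurable_sum => i; exact: mM. Qed.

End MeasurableMatrix.

(** * Comparison of integrals *)

Section Integrals.
Local Open Scope ereal_scope.
Context d (T : measurableType d) (R : realType) (P : probability T R).

Import HBNNSimple.

(** The integral of a nonnegative function is a supremum over the simple functions below it, which
    gives monotonicity without measurability. This serves for the operator norm, whose measurability
    is not established here. *)
Lemma ge0_le_integral_nonmeasurable (mu : {measure set T -> \bar R})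
    (f g : T -> \bar R) :
  (forall x, 0 <= f x) -> (forall x, f x <= g x) ->
  \int[mu]_x f x <= \int[mu]_x g x.
Proof.
move=> f0 fg; rewrite !ge0_integralTE//; last first.
  by move=> x; exact: le_trans (f0 x) (fg x).
apply: ge_ereal_sup => _ [h hf <-]; apply: ereal_sup_ubound; exists h => //= x.
exact: le_trans (hf x) (fg x).
Qed.

(** Since [h] vanishes off [I], only the law of [X] restricted to [I] matters, and it is at most [K]
    times Lebesgue measure there. *)
Lemma integral_density_le (X : {RV P >-> R}) (f : R -> R) (I : set R) (K : R)
    (h : R -> R) :
  has_density X f -> measurable I -> (0 <= K)%R ->
  (forall x, I x -> f x <= K)%R ->
  measurable_fun setT h -> (forall x, 0 <= h x)%R ->
  (forall x, ~ I x -> h x = 0%R) ->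
  \int[P]_w (h (X w))%:E <= K%:E * \int[@lebesgue_measure R]_(x in I) (h x)%:E.
Proof.
move=> [mf f0 fE] mI K0 fK mh h0 hI.
(* [lebesgue_measure] lives on [measurableTypeR R], whose display differs from
   the one of [R]: the law of [X] is transported there. *)
have mhE : measurable_fun [set: measurableTypeR R] (EFin \o h).
  exact/measurable_EFinP.
have mX : measurable_fun [set: T] (X : T -> measurableTypeR R).
  by move=> _ B mB; exact: (measurable_funPT X measurableT B mB).
pose X' : {mfun T >-> measurableTypeR R} := HB.pack (X : T -> measurableTypeR R)
  (isMeasurableFun.Build _ _ _ _ _ mX).
have h0E x : 0 <= (EFin \o h) x by rewrite lee_fin.
rewrite [leLHS](_ : _ = \int[distribution P X']_x (EFin \o h) x); last first.
  by rewrite ge0_integral_distribution.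
rewrite (_ : \int[distribution P X']_x _ =
    \int[distribution P X']_(x in I) (EFin \o h) x); last first.
  rewrite [RHS]integral_mkcond; apply: eq_integral => x _; rewrite patchE.
  by case: ifPn => //= /negP; rewrite inE => /hI ->.
rewrite (eq_measure_integral (mrestr (distribution P X') mI)); last first.
  by move=> A mA AI; rewrite /= /mrestr setIidl.
have <- : \int[mscale (NngNum K0) (@lebesgue_measure R)]_(x in I) (EFin \o h) x =
    K%:E * \int[@lebesgue_measure R]_(x in I) (h x)%:E.
  rewrite (@ge0_integral_mscale _ _ _ (@lebesgue_measure R) _ mI)//.
  exact: measurable_funTS.
apply: ge0_le_measure_integral => // S mS.
rewrite [leLHS](_ : _ = distribution P X (S `&` I))// fE; last exact: measurableI.
apply: (@le_trans _ _ (\int[lebesgue_measure]_(x in S `&` I) K%:E)).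
  apply: ge0_le_integral => //.
  - exact: measurableI.
  - by move=> x _; rewrite lee_fin.
  - by apply/measurable_EFinP; exact: measurable_funTS.
  - by move=> x [_ /fK]; rewrite lee_fin.
rewrite integral_cst; last exact: measurableI.
apply: lee_wpmul2l; first by rewrite lee_fin.
by apply: le_measure; rewrite ?inE//; exact: measurableI.
Qed.
End Integrals.

(** * The estimator *)

Section Estimator.
Context {R : realType} (phi : nat -> R -> R) (n m p : nat).
Context (Delta : 'M[R]_(m, m + p)) (x : 'I_n -> R) (n_gt0 : (0 < n)%N).

Let Phim : 'M[R]_(n, m) := Phi_hat phi m x.
Let Phi : 'M[R]_(n, m + p) := Phi_hat phi (m + p)%N x.
Let G := Phi^T *m Phi.

Definition hat_mx : 'M[R]_n := Phim *m Delta *m invmx G *m Phi^T.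

Hypothesis Psi_unit : Psi_hat phi (m + p)%N x \in unitmx.

Let G_unit : G \in unitmx.
Proof.
move: Psi_unit; rewrite /Psi_hat -mul_scalar_mx unitmx_mul => /andP[_].
by [].
Qed.

(** The factor [1/n] of the estimator cancels the one inside [Psi_hat], leaving the inverse of
    [G]. *)
Lemma b_hat'E y :
  \col_i b_hat' phi Delta x y (x i) = - (hat_mx *m y).
Proof.
have -> : \col_i b_hat' phi Delta x y (x i) = Phim *m theta_hat phi Delta x y.
  apply/colP => i; rewrite !mxE; apply: eq_bigr => j _.
  by rewrite [RHS]mulrC !mxE.
rewrite /theta_hat mulmxN; congr (- _).
rewrite /Psi_hat invmxZ ?invrK; last exact: Psi_unit.
rewrite -!scalemxAr -!scalemxAl -!scalemxAr scalerA mulVf; last first.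
  by rewrite pnatr_eq0 -lt0n.
rewrite scale1r.
by rewrite /hat_mx !mulmxA.
Qed.

(** Since [invmx G *m Phi^T *m Phi] is the identity, the sample values of the function of [S_(m+p)]
    with coefficients [c] go to those of the function of [S_m] with coefficients [Delta c]. *)
Lemma hat_mx_span (c : 'cV[R]_(m + p)) :
  hat_mx *m (Phi *m c) = Phim *m (Delta *m c).
Proof.
by rewrite /hat_mx -!mulmxA (mulmxA Phi^T) (mulKmx G_unit).
Qed.

(** [Phi^T] kills the coordinates at which all basis functions vanish. This allows [b] to be
    replaced by its restriction to [I] although some sample points may lie outside [I]. *)
Lemma hat_mx_supp (u v : 'cV[R]_n) :
  (forall j i, phi j (x i) != 0 -> u i 0 = v i 0) -> hat_mx *m u = hat_mx *m v.
Proof.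
move=> uv; rewrite /hat_mx -!(mulmxA _ Phi^T); congr (_ *m _).
apply/colP => j; rewrite !mxE; apply: eq_bigr => i _; rewrite !mxE.
by have [->|/uv ->//] := eqVneq (phi j (x i)) 0; rewrite !mul0r.
Qed.

(** The squared Frobenius norm is [tr (H H^T)], in which [Phi^T Phi = G] cancels one of the two
    inverses; cyclicity of the trace then reorders the factors. *)
Lemma hat_mx_trace : \sum_i \sum_j hat_mx i j ^+ 2 =
  \tr (invmx G *m Delta^T *m Phim^T *m Phim *m Delta).
Proof.
have -> (H : 'M[R]_n) : \sum_i \sum_j H i j ^+ 2 = \tr (H *m H^T).
  apply: eq_bigr => i _; rewrite mxE; apply: eq_bigr => j _.
  by rewrite mxE expr2.
have GT : (invmx G)^T = invmx G by rewrite trmx_inv trmx_mul trmxK.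
rewrite /hat_mx !trmx_mul trmxK GT -!mulmxA (mulmxA Phi^T Phi) -/G.
rewrite (mulKVmx G_unit) mxtrace_mulC -!mulmxA mxtrace_mulC.
by rewrite -!mulmxA.
Qed.

End Estimator.

(** Up to values outside [I], which [hat_mx] ignores, the data split as [(bI - bproj) + bproj + e];
    [hat_mx_span] sends the middle term to [- b'proj]. *)
Lemma b_hat'_residual (R : realType) (phi : nat -> R -> R) (n m p : nat)
    (Delta : 'M[R]_(m, m + p)) (x e : 'I_n -> R) (I : set R)
    (b b' : R -> R) (c : 'I_(m + p) -> R) :
    (0 < n)%N -> Psi_hat phi (m + p)%N x \in unitmx ->
    (forall j u, ~ I u -> phi j u = 0) ->
  let bproj := fun u => \sum_k c k * phi k u in
  let b'proj := fun u => \sum_j (- \sum_k Delta j k * c k) * phi j u in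
  forall i, b_hat' phi Delta x (\col_i (b (x i) + e i)) (x i) - b' (x i) =
    - (b' (x i) - b'proj (x i)
       + (hat_mx phi Delta x *m \col_i ((b \_ I) (x i) - bproj (x i))) i 0
       + \sum_j hat_mx phi Delta x i j * e j).
Proof.
move=> n_gt0 Psi_unit supp bproj b'proj i.
have := congr1 (fun A : 'cV_n => A i 0)
  (b_hat'E Delta n_gt0 Psi_unit (\col_i (b (x i) + e i))).
rewrite mxE [in X in _ = X -> _]mxE => ->.
set H := hat_mx phi Delta x; set v := \col_i (_ - bproj _).
set cc := \col_k c k.
have -> : H *m \col_i (b (x i) + e i) =
    H *m v + H *m (Phi_hat phi (m + p)%N x *m cc) + H *m \col_i e i.
  rewrite -!mulmxDr; apply: hat_mx_supp => j l phi0; rewrite !mxE.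
  rewrite (_ : \sum_j0 _ = bproj (x l)).
    rewrite patchE mem_set ?subrK//.
    by apply: contrapT => /(supp j) e0; rewrite e0 eqxx in phi0.
  by apply: eq_bigr => k _; rewrite !mxE mulrC.
rewrite (hat_mx_span Delta Psi_unit) !mxE.
have -> : \sum_j Phi_hat phi m x i j * (Delta *m cc) j 0 = - b'proj (x i).
  rewrite /b'proj -sumrN; apply: eq_bigr => j _; rewrite !mxE mulNr opprK mulrC.
  by congr (_ * _); apply: eq_bigr => k _; rewrite mxE.
have -> : \sum_j H i j * (\col_i0 e i0) j 0 = \sum_j H i j * e j.
  by apply: eq_bigr => j _; rewrite mxE.
ring.
Qed.

Lemma centered_iid_covariance d (T : measurableType d) (R : realType)
    (P : probability T R) (n : nat) (eps : 'I_n -> {RV P >-> R}) (sigma : R) :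
    mutually_independent eps ->
    (forall i, (eps i : T -> R) \in Lfun P 2%:E) ->
    (forall i, ('E_P[eps i] = 0)%E) ->
    (forall i, ('V_P[eps i] = (sigma ^+ 2)%:E)%E) ->
  forall j k, ('E_P[(eps j \* eps k)%R] = (sigma ^+ 2 *+ (j == k))%:E)%E.
Proof.
move=> indep eps2 eps0 epsV j k; have [<-|jk] := eqVneq j k.
  rewrite mulr1n -(epsV j) varianceE// eps0 expe2 mule0 sube0.
  by congr expectation; apply/funext => w; rewrite /= expr2.
have eps1 i : (eps i : T -> R) \in Lfun P 1.
  by rewrite Lfun_subset12 ?fin_num_measure.
have [|_ ->] := @expectation_mul_independent _ T R P (eps j) (eps k)
    _ (eps1 j) (eps1 k).
  move=> A B mA mB.
  (* Mutual independence on the pair [{j, k}], with [A] assigned to [j] and [B] to every other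
     index. *)
  have := indep [set j; k]%SET (fun i => if i == j then A else B).
  rewrite big_setU1 ?inE//= big_set1 eqxx eq_sym (negbTE jk) => <-.
    congr (P _); apply/seteqP; split => w /=.
      move=> [wA wB] i; rewrite /= !inE => /orP[/eqP ->|/eqP ->].
        by rewrite eqxx.
      by rewrite eq_sym (negbTE jk).
    move=> wAB; split.
      by have := wAB j; rewrite /= !inE !eqxx; apply.
    by have := wAB k; rewrite /= !inE eqxx orbT eq_sym (negbTE jk); apply.
  by move=> i; case: ifP.
by rewrite eps0 mul0e mulr0n.
Qed.

(** * Bias, approximation and noise terms of the risk *)

Theorem proposition3p6 (R : realType)
  (d : measure_display) (Omega : measurableType d) (P : probability Omega R)
  (n : nat) (n_gt0 : (0 < n)%N)
  (b : R -> R) (b_derivable : forall x : R, derivable b x 1)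
  (b'_continuous : continuous (derive1 b))
  (X : 'I_n -> {RV P >-> R}) (f : R -> R)
  (X_iid : iid X) (X_density : forall i, has_density (X i) f)
  (eps : 'I_n -> {RV P >-> R}) (sigma : R)
  (eps_iid : iid eps)
  (eps_L2 : forall i, (eps i : Omega -> R) \in Lfun P 2%:E)
  (eps_centered : forall i, ('E_P[eps i] = 0)%E)
  (eps_variance : forall i, ('V_P[eps i] = (sigma ^+ 2)%:E)%E)
  (eps_X_independent : independent_vectors eps X)
  (I : set R) (I_interval : is_interval I)
  (b_L2 : L2 I b) (b'_L2 : L2 I (derive1 b))
  (phi : nat -> R -> R)
  (phi_supp : forall j x, ~ I x -> phi j x = 0)
  (phi_derivable : forall j, derivable_on I (phi j))
  (phi_basis : hilbert_basis I phi)
  (m p : nat) (m_gt0 : (0 < m)%N)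
  (Psi_inv : \forall w \ae P, Psi_hat phi (m + p)%N (fun i => X i w) \in unitmx)
  (bproj : R -> R) (bprojP : is_orth_proj I (Sspan phi (m + p)%N) b bproj)
  (f_bounded : [bounded f x | x in I])
  (phi'_span : forall j, (j < m)%N -> Sspan phi (j.+1 + p)%N (derive_on I (phi j)))
  (boundary : forall j, (j < m)%N -> equal_boundary_values I (b \* phi j))
  (Delta : 'M[R]_(m, m + p))
  (DeltaP : forall (j : 'I_m) x,
     derive_on I (phi j) x = \sum_(k < (m + p)%N) Delta j k * phi k x) :
  let x := fun w i => X i w in
  let y := fun w => \col_(i < n) (b (X i w) + eps i w) in
  let Phi := fun k w => Phi_hat phi k (x w) in
  let G := fun w => (Phi (m + p)%N w)^T *m Phi (m + p)%N w in
  ('E_P[fun w =>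
      (emp_norm2 (x w) (b_hat' phi Delta (x w) (y w) \- (derive1 b \_ I)))%R]
   <= (2 * sup [set f u | u in I])%:E *
        ereal_inf [set (L2norm I (t \- derive1 b)%R ^+ 2)%E | t in Sspan phi m]
      + 2%:E * 'E_P[fun w =>
          (op_norm (Phi m w *m Delta *m invmx (G w) *m (Phi (m + p)%N w)^T) ^+ 2
           * emp_norm2 (x w) ((b \_ I) \- bproj))%R]
      + (sigma ^+ 2 / n%:R)%:E * 'E_P[fun w =>
          (\tr (invmx (G w) *m Delta^T *m (Phi m w)^T *m Phi m w *m Delta))%R])%E.
Proof.
cbv zeta.
pose x w i := X i w.
pose y w : 'cV[R]_n := \col_i (b (X i w) + eps i w).
pose Phi k w := Phi_hat phi k (x w).
pose G w := (Phi (m + p)%N w)^T *m Phi (m + p)%N w.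
have mI := is_interval_measurable I_interval.
have [phi_L2 phi_orth _] := phi_basis.
(* [I] is not null because [phi 0] has norm 1 on it. *)
have I_neq0 : lebesgue_measure I != 0%E.
  apply/eqP => I0; have := phi_orth 0%N 0%N; rewrite eqxx /L2inner /Rintegral.
  have i0 := L2_mul_integrable mI (phi_L2 0%N) (phi_L2 0%N).
  rewrite (null_set_integral (mu := @lebesgue_measure R)
    mI (measurable_int _ i0) I0).
  by move/eqP; rewrite eq_sym oner_eq0.
(* A point of [I], at which [0 <= f c <= K] will give [0 <= K]. *)
have [c [_ [/(inner_sub I_interval) Ic _ _]]] := inner_pair I_interval I_neq0.
set K := sup _.
have fK u : I u -> f u <= K.
  move=> Iu; apply: ub_le_sup; last by exists u.
  case: f_bounded => M [_ fM]; exists (M + 1) => _ [t It <-].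
  by apply: le_trans (ler_norm _) _; apply: (fM (M + 1)) => //; rewrite ltrDl.
have K0 : 0 <= K.
  have [_ f0 _] := X_density (Ordinal n_gt0).
  exact: le_trans (f0 c) (fK _ Ic).
have [[cb _ cbE] _] := bprojP; subst bproj; set bproj := fun u => _ in bprojP *.
have cbP k : cb k = L2inner I b (phi k).
  by apply: (orth_proj_coef I_interval cb phi_basis b_L2).1.
(* Coefficients of [b'_m]: [<b', phi_j> = - <b, phi_j'> = - sum_k Delta_jk <b, phi_k>]. *)
pose cb' (j : 'I_m) := - \sum_k Delta j k * cb k.
pose b'proj u := \sum_j cb' j * phi j u.
have phi'E (j : 'I_m) :
    derive_on I (phi j) = (fun u => \sum_k Delta j k * phi k u).
  by apply/funext => u; exact: DeltaP.
have b'projP : is_orth_proj I (Sspan phi m) (derive1 b) b'proj.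
  apply/(orth_proj_coef I_interval cb' phi_basis b'_L2) => j.
  have phi'_L2 : L2 I (derive_on I (phi j)) by rewrite phi'E; exact: L2_sum.
  rewrite (L2inner_by_parts I_interval)//; last first.
  - exact: boundary.
  (* [phi_j'] is a combination of functions differentiable on [I], hence continuous on the
     interior. *)
  - move=> u inu; rewrite phi'E.
    apply: (@cvg_big _ _ _ _ _ _ _ (nbhs u)) => [|k _]; first exact: add_continuous.
    apply: cvgM; [exact: cvg_cst|exact: (derivable_on_continuous I_interval)].
  rewrite L2innerC phi'E L2inner_sum//; congr (- _).
  by apply: eq_bigr => k _; rewrite L2innerC cbP.
have b'proj_le t : Sspan phi m t ->
    (L2norm I (b'proj \- derive1 b)%R ^+ 2 <= L2norm I (t \- derive1 b)%R ^+ 2)%E.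
  apply: orth_proj_minimizes b'projP => //.
    by move=> _ [e _ <-]; exact: L2_sum.
  move=> _ _ [e _ <-] [e' _ <-]; exists (fun i => e i - e' i) => //.
  by apply/funext => u /=; rewrite -sumrB; apply: eq_bigr => i _; rewrite mulrBl.
pose bI := b \_ I. pose b'I := derive1 b \_ I.
pose H w := hat_mx phi Delta (x w).
pose v w : 'cV[R]_n := \col_i (bI (X i w) - bproj (X i w)).
pose u i w := b'I (X i w) - b'proj (X i w).
(* Measurability is proved for the sigma-algebra of the design, as independence from the noise
   requires, and then transported to [Omega] by [toT]. *)
pose F := preimages (fun i => X i : Omega -> R).
have FT : F `<=` measurable by apply: preimages_measurable => i.
pose TF := g_sigma_algebraType F.
have L2_measurable g : L2 I g -> measurable_fun setT (g \_ I).
  by rewrite /L2 inE => /andP[]; rewrite inE.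
have mphi j : measurable_fun setT (phi j).
  rewrite (_ : phi j = phi j \_ I); first exact: L2_measurable.
  apply/funext => t; rewrite patchE; case: ifPn => // /negP.
  by rewrite inE => /phi_supp ->.
have mbI : measurable_fun setT bI by exact: L2_measurable.
have mb'I : measurable_fun setT b'I by exact: L2_measurable.
have mlin k (e : 'I_k -> R) : measurable_fun setT (fun t => \sum_j e j * phi j t).
  by apply: measurable_sum => j; exact: measurable_funM.
have mcomp (g : R -> R) i : measurable_fun setT g ->
    measurable_fun [set: TF] ((fun w => g (X i w)) : TF -> R).
  move=> mg; apply: (measurableT_comp mg).
  exact: (@measurable_preimages _ Omega R n (fun i => X i) i).
have mPhi k : measurable_mx ((fun w => Phi k w) : TF -> _).
  move=> i j; under eq_fun do rewrite mxE.
  exact: mcomp.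
have mH : measurable_mx (H : TF -> _).
  apply: measurable_mulmx; last exact: measurable_trmx.
  apply: measurable_mulmx.
    by apply: measurable_mulmx => //; exact: measurable_cst_mx.
  by apply/measurable_invmx/measurable_mulmx => //; exact: measurable_trmx.
have mv : measurable_mx (v : TF -> _).
  move=> i j; under eq_fun do rewrite mxE.
  by apply: measurable_funB; apply: mcomp => //; exact: mlin.
have mu i : measurable_fun [set: TF] (u i : TF -> R).
  by apply: measurable_funB; apply: mcomp => //; exact: mlin.
have mHv : measurable_mx ((fun w => H w *m v w) : TF -> _).
  exact: measurable_mulmx.
(* Up to sign, the part of the residual that depends on the design only. *)
pose a i w := u i w + (H w *m v w) i 0.
have noise i := noise_second_moment FT eps_X_independent eps_L2 eps_centered
  (centered_iid_covariance eps_iid.1 eps_L2 eps_centered eps_variance)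
  (measurable_funD (mu i) (mHv i 0)) (mH i) (sqr_ge0 sigma).
have toT (g : Omega -> R) : measurable_fun [set: TF] (g : TF -> R) ->
    measurable_fun setT g.
  exact: measurable_fun_g_sigma.
have maT i : measurable_fun setT (a i).
  by apply: toT; apply: measurable_funD.
have muT i : measurable_fun setT (u i) by exact: toT.
have mHT : measurable_mx H by move=> i j; exact: (toT _ (mH i j)).
have mHvT : measurable_mx (fun w => H w *m v w).
  by move=> i j; exact: (toT _ (mHv i j)).
have mPhiT k : measurable_mx (fun w => Phi k w).
  by move=> i j; exact: (toT _ (mPhi k i j)).
pose S w := \sum_i \sum_j H w i j ^+ 2.
have mS : measurable_fun setT S.
  apply: measurable_sum => i; apply: measurable_sum => j.
  exact: measurable_funX.
have S0 w : 0 <= S w.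
  by apply: sumr_ge0 => i _; apply: sumr_ge0 => j _; exact: sqr_ge0.
have ninv0 : 0 <= (n%:R : R)^-1 by rewrite invr_ge0.
have integral_add (g h : Omega -> R) :
    measurable_fun setT g -> measurable_fun setT h ->
    (forall w, 0 <= g w) -> (forall w, 0 <= h w) ->
    (\int[P]_w (g w + h w)%:E = \int[P]_w (g w)%:E + \int[P]_w (h w)%:E)%E.
  move=> mg mh g0 h0; under eq_integral do rewrite EFinD.
  apply: ge0_integralD => //; try exact/measurable_EFinP.
  - by move=> w _; rewrite lee_fin.
  - by move=> w _; rewrite lee_fin.
have integral_scale k (g : Omega -> R) :
    measurable_fun setT g -> 0 <= k -> (forall w, 0 <= g w) ->
    (\int[P]_w (k * g w)%:E = k%:E * \int[P]_w (g w)%:E)%E.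
  move=> mg k0 g0; under eq_integral do rewrite EFinM.
  apply: ge0_integralZl_EFin => //; last exact/measurable_EFinP.
  by move=> w _; rewrite lee_fin.
have avg_integral (g : 'I_n -> Omega -> R) :
    (forall i, measurable_fun setT (g i)) -> (forall i w, 0 <= g i w) ->
    (\int[P]_w (n%:R^-1 * \sum_i g i w)%:E =
     (n%:R^-1)%:E * \sum_i \int[P]_w (g i w)%:E)%E.
  move=> mg g0; rewrite integral_scale//; last 2 first.
  - exact: measurable_sum.
  - by move=> w; exact: sumr_ge0.
  under eq_integral do rewrite -sumEFin.
  rewrite ge0_integral_sum// => [i|i w _]; last by rewrite lee_fin.
  exact/measurable_EFinP.
pose q i w := (a i w + \sum_j H w i j * eps j w) ^+ 2.
have mq i : measurable_fun setT (q i).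
  apply: measurable_funX; apply: measurable_funD => //.
  by apply: measurable_sum => j; exact: measurable_funM.
pose r i w := a i w ^+ 2 + sigma ^+ 2 * \sum_j H w i j ^+ 2.
have mr i : measurable_fun setT (r i).
  apply: measurable_funD; first exact: measurable_funX.
  apply: measurable_funM => //; apply: measurable_sum => j.
  exact: measurable_funX.
have r0 i w : 0 <= r i w.
  rewrite addr_ge0 ?sqr_ge0// mulr_ge0 ?sqr_ge0//.
  by apply: sumr_ge0 => j _; exact: sqr_ge0.
have mtheta : measurable_mx (fun w => theta_hat phi Delta (x w) (y w)).
  have mPhiTT k := measurable_trmx (mPhiT k).
  apply/measurable_oppmx/measurable_scalemx/measurable_mulmx.
    apply: measurable_mulmx => //; apply: measurable_mulmx.
      exact: measurable_cst_mx.
    by apply/measurable_invmx/measurable_scalemx/measurable_mulmx.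
  move=> i j; under eq_fun do rewrite mxE.
  apply: measurable_funD => //; apply: toT; apply: mcomp.
  apply: continuous_measurable_fun => t.
  exact/differentiable_continuous/derivable1_diffP.
(* Almost surely [Psi_hat] is invertible and the loss is the average of the [q i]; [noise] then
   replaces each [q i] by [r i] in expectation, without cross term. *)
have -> : ('E_P[fun w =>
      (emp_norm2 (x w) (b_hat' phi Delta (x w) (y w) \- b'I))%R] =
    \int[P]_w (n%:R^-1 * \sum_i r i w)%:E)%E.
  transitivity (\int[P]_w (n%:R^-1 * \sum_i q i w)%:E)%E; last first.
    rewrite !avg_integral//; last by move=> i w; exact: sqr_ge0.
    by congr (_ * _)%E; apply: eq_bigr => i _; exact: noise.
  rewrite [@expectation]unlock; apply: ae_eq_integral => //.
  - apply/measurable_EFinP; apply: measurable_funM => //.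
    apply: measurable_sum => i; apply: measurable_funX.
    apply: measurable_funB; last exact: (toT _ (mcomp _ i mb'I)).
    apply: measurable_sum => j; apply: measurable_funM; first exact: mtheta.
    exact: (toT _ (mcomp _ i (mphi j))).
  - apply/measurable_EFinP; apply: measurable_funM => //; exact: measurable_sum.
  - apply: filterS Psi_inv => w Psi_unit _ /=.
    congr (_ * _)%:E; apply: eq_bigr => i _; rewrite /q /a /u -sqrrN.
    have E := @b_hat'_residual R phi n m p Delta (x w) (fun i => eps i w)
      I b b'I cb n_gt0 Psi_unit phi_supp i.
    by congr (_ ^+ 2); apply: (etrans (congr1 -%R E)); rewrite opprK.
(* [t1] will be bounded through the density and [t2] through the operator norm, while the
   expectation of [t3] is exactly the trace term. *)
pose t1 w := 2 * (n%:R^-1 * \sum_i u i w ^+ 2).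
pose t2 w := 2 * (n%:R^-1 * \sum_i (H w *m v w) i 0 ^+ 2).
pose t3 w := (sigma ^+ 2 / n%:R) * S w.
have mt1 : measurable_fun setT t1.
  apply: measurable_funM => //; apply: measurable_funM => //.
  by apply: measurable_sum => i; exact: measurable_funX.
have mt2 : measurable_fun setT t2.
  apply: measurable_funM => //; apply: measurable_funM => //.
  by apply: measurable_sum => i; exact: measurable_funX.
have mt3 : measurable_fun setT t3 by exact: measurable_funM.
have sum0 (g : 'I_n -> R) : 0 <= n%:R^-1 * \sum_i g i ^+ 2.
  by rewrite mulr_ge0// sumr_ge0// => i _; exact: sqr_ge0.
have t10 w : 0 <= t1 w by rewrite mulr_ge0.
have t20 w : 0 <= t2 w by rewrite mulr_ge0.
have t30 w : 0 <= t3 w by rewrite mulr_ge0// divr_ge0 ?sqr_ge0.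
apply: (@le_trans _ _ (\int[P]_w (t1 w + t2 w + t3 w)%:E)%E).
  apply: ge0_le_integral => //.
  - by move=> w _; rewrite lee_fin mulr_ge0// sumr_ge0.
  - by apply/measurable_EFinP; apply: measurable_funM => //; exact: measurable_sum.
  - by apply/measurable_EFinP; do 2!apply: measurable_funD => //.
  move=> w _; rewrite lee_fin /t1 /t2 /t3 /S /r big_split /= -mulr_sumr.
  set A := \sum_i a i w ^+ 2; set B := \sum_i u i w ^+ 2.
  set C := \sum_i (_ *m _) i 0 ^+ 2; set D := \sum_i \sum_j _.
  have ABC : A <= 2 * B + 2 * C.
    rewrite 2!mulr_sumr -big_split /=; apply: ler_sum => i _.
    rewrite /a; set s1 := u i w; set s2 := (_ *m _) i 0.
    by have := sqr_ge0 (s1 - s2); lra.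
  rewrite -subr_ge0.
  have -> : 2 * (n%:R^-1 * B) + 2 * (n%:R^-1 * C) + sigma ^+ 2 / n%:R * D -
      n%:R^-1 * (A + sigma ^+ 2 * D) = n%:R^-1 * (2 * B + 2 * C - A) by ring.
  by rewrite mulr_ge0// subr_ge0.
rewrite integral_add//; last 2 first.
- exact: measurable_funD.
- by move=> w; exact: addr_ge0.
apply: leeD; last first.
  rewrite le_eqVlt; apply/orP; left; apply/eqP.
  rewrite integral_scale ?divr_ge0 ?sqr_ge0//.
  congr (_ * _)%E; rewrite [@expectation]unlock; apply: ae_eq_integral => //.
  - exact/measurable_EFinP.
  - apply/measurable_EFinP/measurable_mxtrace.
    have mPhiTT k := measurable_trmx (mPhiT k).
    do 4?[apply: measurable_mulmx => //]; try exact: measurable_cst_mx.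
    by apply/measurable_invmx/measurable_mulmx.
  - apply: filterS Psi_inv => w Psi_unit _ /=; congr EFin.
    exact: (hat_mx_trace Delta Psi_unit).
rewrite integral_add//.
apply: leeD; last first.
  rewrite integral_scale//; last first.
    apply: measurable_funM => //.
    by apply: measurable_sum => i; exact: measurable_funX.
  apply: lee_wpmul2l; first by rewrite lee_fin.
  rewrite [@expectation]unlock.
  apply: (@ge0_le_integral_nonmeasurable _ _ _ P) => w; rewrite lee_fin//.
  rewrite /emp_norm2 mulrCA ler_wpM2l//.
  have -> : \sum_(i < n) ((b \_ I) \- bproj) (x w i) ^+ 2 =
      \sum_i v w i 0 ^+ 2 by apply: eq_bigr => i _; rewrite mxE.
  exact: op_norm_mulmx.
rewrite integral_scale//; last first.
  apply: measurable_funM => //.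
  by apply: measurable_sum => i; exact: measurable_funX.
rewrite EFinM -muleA; apply: lee_wpmul2l; first by rewrite lee_fin.
rewrite avg_integral//; last 2 first.
  by move=> i; exact: measurable_funX.
  by move=> i w; exact: sqr_ge0.
pose h t := (b'I t - b'proj t) ^+ 2.
(* All [X i] have density [f], so the same bound holds at each sample point and survives
   averaging. *)
have hP i : (\int[P]_w (u i w ^+ 2)%:E <=
    K%:E * L2norm I (b'proj \- derive1 b)%R ^+ 2)%E.
  rewrite sqr_L2norm//.
  rewrite (@eq_integral _ _ _ lebesgue_measure I (EFin \o h)); last first.
    move=> t It; rewrite /= /h /b'I patchE It.
    by congr EFin; ring.
  apply: (integral_density_le (X_density i) mI K0 fK (h := h)) => //.
  - apply: measurable_funX; apply: measurable_funB => //; exact: mlin.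
  - by move=> t; exact: sqr_ge0.
  - move=> t nIt; rewrite /h /b'I patchE memNset// /b'proj.
    by rewrite big1 ?subrr ?expr0n// => j _; rewrite phi_supp ?mulr0.
apply: (@le_trans _ _ (K%:E * L2norm I (b'proj \- derive1 b)%R ^+ 2)%E).
  set B := (X in (_ <= X)%E).
  apply: (@le_trans _ _ ((n%:R^-1)%:E * \sum_(i < n) B)%E).
    by apply: lee_wpmul2l; rewrite ?lee_fin//; apply: lee_sum => i _; exact: hP.
  have -> : (\sum_(i < n) B = n%:R%:E * B)%E.
    rewrite -[in RHS](card_ord n) -sumr_const -sumEFin ge0_sume_distrl.
      by apply: eq_bigr => i _; rewrite mul1e.
    by move=> i _; rewrite lee_fin.
  by rewrite muleA -EFinM mulVf ?mul1e// pnatr_eq0 -lt0n.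
apply: lee_wpmul2l; first by rewrite lee_fin.
by apply: le_ereal_inf_tmp => _ [t St <-]; exact: b'proj_le.
Qed.
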